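(* Let $w\in F$ be a dead end element, i.e. $|w\alpha|=|w|-1$ for every $\alpha\in\{x_0^{\pm1},x_1^{\pm1}\}$, and let $(T_-,T_+)$ be its reduced tree pair diagram. Then $(T_-,T_+)$ has the following form. (i) In $T_-$: the root caret $b$ has a left child $a$ and a right child $d$; the caret $d$ has a left child $c$ and a right child $e$; the left subtree of $e$ is empty; and the right subtree $E$ of $e$ is nonempty. (The left and right subtrees $A,B$ of $a$ and $C,D$ of $c$ are arbitrary, possibly empty.) (ii) In $T_+$, writing again $b,d,e$ for the carets having the same infix numbers as the carets $b,d,e$ of $T_-$: the caret $b$ is a left caret other than caret number $0$, and its left subtree $A'$ is nonempty; the caret $d$ is a right caret whose right child is $e$; the left subtree of $e$ is empty; and the right subtree $E'$ of $e$ is nonempty.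
   Context: Thompson's group $F$ is the group with infinite presentation $\langle x_k,\ k\ge 0 \mid x_i^{-1}x_jx_i=x_{j+1}\ \text{for } i<j\rangle$; it is generated by $x_0,x_1$. $|w|$ denotes word length with respect to $\{x_0^{\pm1},x_1^{\pm1}\}$. Tree pair diagrams: A tree is a finite rooted binary tree in which every vertex has either no children or two (left and right) children. A caret is a non-leaf node together with its two downward edges; the left (right) child of a caret is the caret attached to the end of its left (right) edge, if any, and its left (right) subtree is the set of all carets stemming from its left (right) edge, which is empty if that edge ends in a leaf. The exposed leaves of a tree are numbered from left to right starting with $0$. A tree pair diagram $(T_-,T_+)$ is a pair of such trees with the same number of carets. The pair is unreduced if, for some $m$, both $T_-$ and $T_+$ contain a caret both of whose leaves are exposed, with leaf numbers $m$ and $m+1$; deleting that caret in both trees gives another diagram for the same element. Each nontrivial element of $F$ has a unique reduced tree pair diagram; the identity is represented by the pair of single-caret trees. Correspondence with elements: the right side of a tree is the maximal path of right edges starting at the root (including the root); the left side is defined similarly. For an exposed leaf $k$ the exponent $E(k)$ is the length of the maximal upward path from leaf $k$ consisting only of left edges and not reaching the right side of the tree ($E(k)=0$ if leaf $k$ is a right leaf). The pair $(T_-,T_+)$ with leaves $0,\dots,m$ represents $x_0^{E_+(0)}x_1^{E_+(1)}\cdots x_m^{E_+(m)}\,x_m^{-E_-(m)}\cdots x_1^{-E_-(1)}x_0^{-E_-(0)}$, where $E_\pm$ are the exponents computed in $T_\pm$. Caret numbering and positions: the carets of a tree are numbered from $0$ in infix order (left subtree of a caret, then the caret, then its right subtree).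 A caret is a left caret if its left edge is on the left side of the tree (the root is a left caret), and a right caret if it is not the root and its right edge is on the right side of the tree. *)

(* Defs.v *)
From HB Require Import structures.
From mathcomp Require Import all_boot all_classical.

Set Implicit Arguments.
Unset Strict Implicit.
Unset Printing Implicit Defensive.

Local Open Scope group_scope.

(** * Thompson's group F *)

(* The letter [(k, false)] stands for x_k and [(k, true)] for x_k^-1. *)
Definition letter : Type := (nat * bool)%type.
Definition linv (l : letter) : letter := (l.1, ~~ l.2).
Definition word : Type := seq letter.
Definition winv (w : word) : word := rev (map linv w).

(* The least congruence making inverse letters cancel and containing the
   relations x_i^-1 x_j x_i = x_(j+1) for i < j. *)
Inductive weq : word -> word -> Prop :=
| weq_refl u : weq u u
| weq_sym u v : weq u v -> weq v u
| weq_trans u v t : weq u v -> weq v t -> weq u t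
| weq_cat u u' v v' : weq u u' -> weq v v' -> weq (u ++ v) (u' ++ v')
| weq_cancel l : weq [:: l; linv l] [::]
| weq_relator i j : i < j ->
    weq [:: (i, true); (j, false); (i, false)] [:: (j.+1, false)].

Definition weqb (u v : word) : bool := `[< weq u v >].

Lemma weqb_equiv : equiv_class_of weqb.
Proof.
split=> [u|u v|v u t].
- by apply/asboolP; apply: weq_refl.
- by apply/asboolP/asboolP; apply: weq_sym.
- by move=> /asboolP uv /asboolP vt; apply/asboolP; apply: weq_trans uv vt.
Qed.

Canonical weqb_equivRel := EquivRelPack weqb_equiv.

Local Open Scope quotient_scope.

Definition thompsonF : Type := {eq_quot weqb}.
HB.instance Definition _ := Choice.on thompsonF.
HB.instance Definition _ := EqQuotient.on thompsonF.

Definition wclass (w : word) : thompsonF := \pi_thompsonF w.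

Lemma wclassP u v : wclass u = wclass v <-> weq u v.
Proof. by split=> [/eqmodP/asboolP|?] //; apply/eqmodP/asboolP. Qed.

Lemma weq_repr w : weq (repr (wclass w)) w.
Proof. by apply/wclassP; rewrite /wclass reprK. Qed.

Lemma wclass_surj (g : thompsonF) : exists w, g = wclass w.
Proof. by exists (repr g); rewrite /wclass reprK. Qed.

Lemma linvK : involutive linv.
Proof. by case=> k b; rewrite /linv /= negbK. Qed.

Lemma winvK : involutive winv.
Proof. by move=> w; rewrite /winv map_rev revK mapK //; apply: linvK. Qed.

Lemma winv_cat u v : winv (u ++ v) = winv v ++ winv u.
Proof. by rewrite /winv map_cat rev_cat. Qed.

Lemma weq_mulV w : weq (w ++ winv w) [::].
Proof.
elim: w => [|l w IH]; first exact: weq_refl.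
have -> : (l :: w) ++ winv (l :: w) = [:: l] ++ ((w ++ winv w) ++ [:: linv l]).
  by rewrite /winv /= rev_cons -cats1 !catA.
apply: weq_trans (weq_cancel l).
apply: (weq_cat (weq_refl [:: l])).
exact: (weq_cat IH (weq_refl [:: linv l])).
Qed.

Lemma weq_Vmul w : weq (winv w ++ w) [::].
Proof. by have := weq_mulV (winv w); rewrite winvK. Qed.

Lemma weq_winv u v : weq u v -> weq (winv u) (winv v).
Proof.
move=> uv.
apply: (@weq_trans _ (winv u ++ (v ++ winv v))).
  rewrite -[X in weq X _]cats0.
  exact: (weq_cat (weq_refl _) (weq_sym (weq_mulV v))).
rewrite catA -[X in weq _ X]cat0s.
apply: weq_cat (weq_refl _).
apply: weq_trans (weq_Vmul u).
exact: (weq_cat (weq_refl _) (weq_sym uv)).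
Qed.

Definition mulF (g h : thompsonF) := wclass (repr g ++ repr h).
Definition invF (g : thompsonF) := wclass (winv (repr g)).

Lemma mulFE u v : mulF (wclass u) (wclass v) = wclass (u ++ v).
Proof. by apply/wclassP; apply: weq_cat; apply: weq_repr. Qed.

Lemma invFE u : invF (wclass u) = wclass (winv u).
Proof. by apply/wclassP; apply: weq_winv; apply: weq_repr. Qed.

Lemma mulFA : associative mulF.
Proof.
move=> g h k; have [u ->] := wclass_surj g; have [v ->] := wclass_surj h.
by have [w ->] := wclass_surj k; rewrite !mulFE catA.
Qed.

Lemma mul1F : left_id (wclass [::]) mulF.
Proof. by move=> g; have [u ->] := wclass_surj g; rewrite mulFE. Qed.

Lemma mulF1 : right_id (wclass [::]) mulF.
Proof. by move=> g; have [u ->] := wclass_surj g; rewrite mulFE cats0. Qed.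

Lemma mulVF : left_inverse (wclass [::]) invF mulF.
Proof.
move=> g; have [u ->] := wclass_surj g; rewrite invFE mulFE.
by apply/wclassP; apply: weq_Vmul.
Qed.

Lemma mulFV : right_inverse (wclass [::]) invF mulF.
Proof.
move=> g; have [u ->] := wclass_surj g; rewrite invFE mulFE.
by apply/wclassP; apply: weq_mulV.
Qed.

HB.instance Definition _ :=
  isGroup.Build thompsonF mulFA mul1F mulF1 mulVF mulFV.

Definition x (k : nat) : thompsonF := wclass [:: (k, false)].

Lemma wclass_mul u v : wclass (u ++ v) = wclass u * wclass v.
Proof. by rewrite -mulFE. Qed.

Lemma wclass_inv u : wclass (winv u) = (wclass u)^-1.
Proof. by rewrite -invFE. Qed.

Lemma x_relation i j : i < j -> (x i)^-1 * x j * x i = x j.+1.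
Proof.
move=> ij; rewrite /x -wclass_inv -[wclass (winv _) * _]wclass_mul -wclass_mul.
by apply/wclassP; apply: weq_relator.
Qed.

(** * Word length and dead ends *)

Definition gens : seq thompsonF := [:: x 0; (x 0)^-1; x 1; (x 1)^-1].

Definition is_product (n : nat) (g : thompsonF) : Prop :=
  exists s : seq thompsonF,
    [/\ size s = n, {subset s <= gens} & \prod_(a <- s) a = g].

Lemma is_productM m n g h :
  is_product m g -> is_product n h -> is_product (m + n) (g * h).
Proof.
move=> [s [<- sg <-]] [t [<- tg <-]]; exists (s ++ t).
split; [by rewrite size_cat | | by rewrite big_cat].
by move=> a; rewrite mem_cat => /orP[/sg|/tg].
Qed.

Lemma is_product1 a : a \in gens -> is_product 1 a.
Proof.
move=> ga; exists [:: a]; split=> //; last by rewrite big_seq1.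
by move=> b; rewrite inE => /eqP->.
Qed.

Lemma generated_x k :
  (exists n, is_product n (x k)) /\ (exists n, is_product n (x k)^-1).
Proof.
have g0 : is_product 1 (x 0) by apply: is_product1; rewrite !inE eqxx.
have g0' : is_product 1 (x 0)^-1.
  by apply: is_product1; rewrite !inE eqxx ?orbT.
case: k => [|k]; first by split; exists 1%N.
elim: k => [|k [[n hn] [m hm]]].
  by split; exists 1%N; apply: is_product1; rewrite !inE eqxx ?orbT.
rewrite -(x_relation (ltn0Sn k)).
split; first by exists (1 + n + 1)%N; do 2?apply: is_productM.
exists (1 + (m + 1))%N; rewrite !invgM invgK.
by do 2?apply: is_productM.
Qed.

Lemma generated (g : thompsonF) : exists n, `[< is_product n g >].
Proof.
have [w ->] := wclass_surj g; elim: w => [|[k b] w [n /asboolP hn]].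
  by exists 0%N; apply/asboolP; exists [::]; rewrite big_nil.
rewrite -cat1s wclass_mul.
have [m hm] : exists m, is_product m (wclass [:: (k, b)]).
  have [hk hk'] := generated_x k.
  by case: b => //; move: hk'; rewrite /x -wclass_inv.
by exists (m + n)%N; apply/asboolP; apply: is_productM.
Qed.

Definition wlength (g : thompsonF) : nat := ex_minn (generated g).

Definition dead_end (w : thompsonF) : Prop :=
  forall a, a \in gens -> (wlength (w * a)).+1 = wlength w.

(** * Trees *)

Inductive tree : Type := Leaf | Caret of tree & tree.

(* The vertices of a tree are addressed by the path from the root:
   [false] is a left edge and [true] a right edge. *)
Local Notation L := false (only parsing).
Local Notation R := true (only parsing).
Definition vertex : Type := seq bool.

Fixpoint leaves (T : tree) : seq vertex :=
  if T is Caret l r then map (cons L) (leaves l) ++ map (cons R) (leaves r)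
  else [:: [::]].

(* A caret is addressed by its upper vertex; the list is in infix order. *)
Fixpoint carets (T : tree) : seq vertex :=
  if T is Caret l r then
    map (cons L) (carets l) ++ [::] :: map (cons R) (carets r)
  else [::].

Definition leaf_number (T : tree) (v : vertex) : nat := index v (leaves T).
Definition infix_number (T : tree) (v : vertex) : nat := index v (carets T).

Definition on_left_side (v : vertex) : bool := all (pred1 L) v.
Definition on_right_side (v : vertex) : bool := all (pred1 R) v.

Definition left_caret (v : vertex) : bool := on_left_side (rcons v L).
Definition right_caret (v : vertex) : bool :=
  (v != [::]) && on_right_side (rcons v R).

(* [left_path v n]: the [n] edges above [v] are left edges, and no vertex of
   the path that they form is on the right side. *)
Definition left_path (v : vertex) (n : nat) : bool :=
  (drop (size v - n) v == nseq n L)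
    && ((n == 0) || ~~ on_right_side (take (size v - n) v)).

Definition exponent (T : tree) (k : nat) : nat :=
  let v := nth [::] (leaves T) k in
  \max_(n < (size v).+1 | left_path v n) n.

(** * Tree pair diagrams *)

(* In a pair [D], [D.1] is T_- and [D.2] is T_+. *)
Definition same_carets (D : tree * tree) : Prop :=
  size (carets D.1) = size (carets D.2).

Definition exposed_caret (T : tree) (m : nat) : Prop :=
  exists2 v, v \in carets T &
    [/\ rcons v L \in leaves T, leaf_number T (rcons v L) = m,
        rcons v R \in leaves T & leaf_number T (rcons v R) = m.+1].

Definition unreduced (D : tree * tree) : Prop :=
  exists m, exposed_caret D.1 m /\ exposed_caret D.2 m.

Definition element (D : tree * tree) : thompsonF :=
  let m := (size (leaves D.1)).-1 in
  (\prod_(k <- iota 0 m.+1) x k ^+ exponent D.2 k) *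
  (\prod_(k <- rev (iota 0 m.+1)) x k ^- exponent D.1 k).

(* The identity is treated separately: the pair of single-caret trees, which
   represents it, is formally unreduced. *)
Definition reduced_diagram (w : thompsonF) (D : tree * tree) : Prop :=
  [/\ same_carets D, element D = w &
      if w == 1 then D = (Caret Leaf Leaf, Caret Leaf Leaf)
      else ~ unreduced D].

(** * The form of the diagram of a dead end *)

(* The carets b, a, d, c, e of T_-. *)
Definition vb : vertex := [::].
Definition va : vertex := [:: L].
Definition vd : vertex := [:: R].
Definition vc : vertex := [:: R; L].
Definition ve : vertex := [:: R; R].

(* A subtree is empty iff the edge leading to it ends in a leaf, that is, not
   in a caret. *)
Definition form_minus (T : tree) : Prop :=
  [/\ [/\ vb \in carets T, va \in carets T & vd \in carets T],
      vc \in carets T, ve \in carets T,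
      rcons ve L \notin carets T & rcons ve R \in carets T].

Definition form_plus (Tm Tp : tree) : Prop :=
  exists b d e : vertex,
  [/\ [/\ b \in carets Tp, d \in carets Tp & e \in carets Tp],
      [/\ infix_number Tp b = infix_number Tm vb,
          infix_number Tp d = infix_number Tm vd &
          infix_number Tp e = infix_number Tm ve],
      [/\ left_caret b, infix_number Tp b <> 0 & rcons b L \in carets Tp],
      right_caret d /\ e = rcons d R &
      rcons e L \notin carets Tp /\ rcons e R \in carets Tp].

(* Main.v *)
(* A tree is determined by its exponent sequence, and a pair of trees is reduced,
   up to padding by right carets, iff the exponent sequences form the usual
   normal form; its uniqueness follows from the action of F on binary streams.
   Give each caret a label (left, right, interior, or "necessary" if it is not
   left and the next leaf has positive exponent). As in the formulas of Fordham
   and of Belk and Brown, the word length is the number of interior carets plus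
   a sum of weights of the pairs of labels of carets with the same number.
   Multiplication on the right by x_0^-1 or x_1^-1 joins two adjacent trees
   hanging from the right spine of T_-, and changes one label there, except when
   the new caret cancels with one of T_+. Hence every generator changes the sum
   by at most 1, and a case analysis at the top of T_- shows that some
   generator decreases it unless the element is trivial. For a dead end all four
   generators decrease it, and this determines the labels of b and d in T_+ and
   forces the trees hanging from the right spine of T_- to have the stated form. *)
From HB Require Import structures.
From mathcomp Require Import all_boot all_classical zify.
Require Import Defs.

Set Implicit Arguments.
Unset Strict Implicit.
Unset Printing Implicit Defensive.

Local Open Scope group_scope.

(** * Action on binary streams *)

(** Only the moves by x_0^-1 and x_1^-1 are computed directly. They join two trees of T_-, and a
    cancellation can occur only at the joined caret. Multiplication by x_0 or x_1 takes a caret of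
    T_- apart, and if that caret is missing it must first be grafted onto both trees. The bounds for
    x_0 and x_1 are therefore those of the inverse moves read backwards. This is possible because
    [represents] is a relation that determines the pair up to padding, and [total_cost] ignores
    padding. Padding three times gives T_- the shape [Caret l (Caret m (Caret n r))], to which every
    move applies. The delicate point is the tail of right carets: a pair of them has weight 2, but
    is free when only such pairs follow. Hence [right_from] accompanies every argument at the top of
    T_-. For a dead end the pair at d consists of right carets outside this tail, which is what
    makes E and E' nonempty. *)

Definition scons (b : bool) (s : nat -> bool) : nat -> bool :=
  fun n => if n is n'.+1 then s n' else b.
Definition stail (s : nat -> bool) : nat -> bool := fun n => s n.+1.

Lemma scons_eta s : scons (s 0) (stail s) = s.
Proof. by apply/funext; case. Qed.

Lemma scons_inj b : injective (scons b).
Proof. by move=> s t st; apply/funext => n; have := congr1 (@^~ n.+1) st. Qed.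

Variant stream_spec : (nat -> bool) -> Prop :=
  StreamCons b s : stream_spec (scons b s).

Lemma streamP s : stream_spec s.
Proof. by rewrite -(scons_eta s). Qed.

(* [x k] fixes the streams starting with 1^j 0 for j < k, and maps
   1^k 0 s, 1^(k+1) 0 s, 1^(k+2) s to 1^k 00 s, 1^k 01 s, 1^(k+1) s. *)
Fixpoint act_gen (k : nat) (s : nat -> bool) : nat -> bool :=
  if k is k'.+1 then
    if s 0 then scons true (act_gen k' (stail s)) else s
  else if s 0 then
    if s 1%N then stail s else scons false (scons true (stail (stail s)))
  else scons false s.

Fixpoint act_genV (k : nat) (s : nat -> bool) : nat -> bool :=
  if k is k'.+1 then
    if s 0 then scons true (act_genV k' (stail s)) else s
  else if s 0 then scons true s
  else if s 1%N then scons true (scons false (stail (stail s))) else stail s.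

Lemma act_genK k : cancel (act_gen k) (act_genV k).
Proof.
elim: k => [|k IH] s; case: (streamP s) => -[] t //.
  by case: (streamP t) => -[].
by rewrite /= IH.
Qed.

Lemma act_genVK k : cancel (act_genV k) (act_gen k).
Proof.
elim: k => [|k IH] s; case: (streamP s) => -[] t //.
  by case: (streamP t) => -[].
by rewrite /= IH.
Qed.

Lemma act_gen_relation i j s : i < j ->
  act_gen j (act_gen i s) = act_gen i (act_gen j.+1 s).
Proof.
elim: i j s => [|i IH] [|j] s // ij; case: (streamP s) => -[] t //.
- by case: (streamP t) => -[].
- by rewrite /=; congr scons; apply: IH.
Qed.

Definition act_letter (l : letter) := if l.2 then act_genV l.1 else act_gen l.1.

Definition act_word (w : word) (s : nat -> bool) := foldr act_letter s w.

Lemma act_word_cat u v s : act_word (u ++ v) s = act_word u (act_word v s).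
Proof. exact: foldr_cat. Qed.

Lemma act_word_weq u v : weq u v -> act_word u =1 act_word v.
Proof.
elim=> {u v} [//|u v _ IH s|u v t _ IH1 _ IH2 s|u u' v v' _ IH1 _ IH2 s| | ].
- by rewrite IH.
- by rewrite IH1 IH2.
- by rewrite !act_word_cat IH2 IH1.
- by case=> k [] s /=; rewrite /act_letter /= ?act_genK ?act_genVK.
- by move=> i j ij s; rewrite /= /act_letter /= act_gen_relation // act_genK.
Qed.

Definition act (g : thompsonF) := act_word (repr g).

Lemma act_wclass u : act (wclass u) =1 act_word u.
Proof. exact: act_word_weq (weq_repr u). Qed.

Lemma act1 s : act 1 s = s.
Proof. exact: act_wclass. Qed.

Lemma actM g h s : act (g * h) s = act g (act h s).
Proof.
have [u ->] := wclass_surj g; have [v ->] := wclass_surj h.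
by rewrite -wclass_mul !act_wclass act_word_cat.
Qed.

Lemma actx k s : act (x k) s = act_gen k s.
Proof. exact: act_wclass. Qed.

Lemma actK g : cancel (act g) (act g^-1).
Proof. by move=> s; rewrite -actM mulVg act1. Qed.

Lemma actVK g : cancel (act g^-1) (act g).
Proof. by move=> s; rewrite -actM mulgV act1. Qed.

(** * Normal forms *)

Fixpoint pos (k : nat) (e : seq nat) : thompsonF :=
  if e is n :: e' then x k ^+ n * pos k.+1 e' else 1.

Lemma pos_cat k e e' : pos k (e ++ e') = pos k e * pos (k + size e) e'.
Proof.
elim: e k => [|n e IH] k /=; first by rewrite mul1g addn0.
by rewrite IH mulgA addSnnS.
Qed.

Lemma pos_behead k e : pos k e = x k ^+ head 0%N e * pos k.+1 (behead e).
Proof. by case: e => //=; rewrite mulg1. Qed.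

Lemma pos_nseq0 k n : pos k (nseq n 0%N) = 1.
Proof. by elim: n k => //= n IH k; rewrite IH mulg1. Qed.

Lemma mul_xx i j : i < j -> x j * x i = x i * x j.+1.
Proof. by move=> ij; rewrite -(x_relation ij) -!mulgA mulVKg. Qed.

Lemma mul_xX i j n : i < j -> x j * x i ^+ n = x i ^+ n * x (j + n).
Proof.
elim: n j => [|n IH] j ij; first by rewrite mulg1 mul1g addn0.
by rewrite !expgS mulgA mul_xx // -!mulgA IH ?addSnnS // ltnW.
Qed.

Lemma mul_Xx i j n : i < j -> x j ^+ n * x i = x i * x j.+1 ^+ n.
Proof.
move=> ij; elim: n => [|n IH]; first by rewrite mulg1 mul1g.
by rewrite !expgS -mulgA IH !mulgA mul_xx.
Qed.

Lemma pos_mulx i k e : i < k -> pos k e * x i = x i * pos k.+1 e.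
Proof.
elim: e k => [|n e IH] k ik /=; first by rewrite mulg1 mul1g.
by rewrite -mulgA (IH _ (leqW ik)) !mulgA mul_Xx.
Qed.

Lemma pos_graft k e1 n e2 :
  pos k (e1 ++ n.+1 :: 0%N :: e2) = pos k (e1 ++ n :: e2) * x (k + size e1).
Proof. by rewrite !pos_cat /= mul1g -!mulgA pos_mulx // expgSr !mulgA. Qed.

(* [s] and [t] are the exponent sequences of the negative and positive parts;
   leaves m and m+1 hang from an exposed caret, not on the right side, iff the
   exponent of m is positive and that of m+1 is zero. *)
Definition normal (s t : seq nat) : Prop := forall m,
  ~~ [&& 0 < nth 0%N s m, 0 < nth 0%N t m,
      nth 0%N s m.+1 == 0%N & nth 0%N t m.+1 == 0%N].

Definition quot (k : nat) (s t : seq nat) : thompsonF := pos k t * (pos k s)^-1.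

Lemma normal_behead s t : normal s t -> normal (behead s) (behead t).
Proof. by move=> st m; have := st m.+1; rewrite !nth_behead. Qed.

Lemma act_posS k e (P := act (pos k.+1 e)) s :
  P (scons false s) = scons false s /\
  P (scons true s) = scons true (act (pos k e) s).
Proof.
rewrite {}/P; elim: e k s => [|n e IH] k s /=; first by rewrite !act1.
rewrite !actM; have [-> ->] := IH k.+1 s.
elim: n (act _ s) => [|n IHn] t; first by rewrite !act1.
by rewrite !expgS !actM; have [-> ->] := IHn t; rewrite !actx.
Qed.

(** Raising all indices by 1 moves the action into the right half. This self-similarity lets
    inductions strip the leading exponents. *)
Lemma act_quotS k s t (Q := act (quot k.+1 s t)) y :
  Q (scons false y) = scons false y /\
  Q (scons true y) = scons true (act (quot k s t) y).
Proof.
have e1 : act (pos k.+1 s)^-1 (scons false y) = scons false y.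
  by have [e _] := act_posS k s y; rewrite -{1}e actK.
have e2 : act (pos k.+1 s)^-1 (scons true y) = scons true (act (pos k s)^-1 y).
  have [_] := act_posS k s (act (pos k s)^-1 y).
  by rewrite actVK => <-; rewrite actK.
rewrite {}/Q /quot !actM e1 e2; split; first by have [] := act_posS k t y.
by have [_ ->] := act_posS k t (act (pos k s)^-1 y).
Qed.

(** * Uniqueness of normal forms *)

Definition zeros (n : nat) (s : nat -> bool) := iter n (scons false) s.

Lemma zerosD m n s : zeros (m + n) s = zeros m (zeros n s).
Proof. exact: iterD. Qed.

Lemma act_x0X n s : act (x 0 ^+ n) (scons false s) = zeros n.+1 s.
Proof.
elim: n => [|n IH]; first by rewrite act1.
by rewrite expgS actM IH actx.
Qed.

Lemma quotE s t :
  quot 0 s t =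
  x 0 ^+ head 0%N t * quot 1 (behead s) (behead t) * x 0 ^- head 0%N s.
Proof. by rewrite /quot pos_behead (pos_behead 0 s) invgM !mulgA. Qed.

Lemma act_quot_zeros s t y :
  act (quot 0 s t) (zeros (head 0%N s).+1 y) = zeros (head 0%N t).+1 y.
Proof.
rewrite quotE 2!actM -[zeros (head _ s).+1 y]act_x0X actK.
by have [-> _] := act_quotS 0 (behead s) (behead t) y; rewrite act_x0X.
Qed.

Definition fixes_left (g : thompsonF) :=
  forall y, act g (scons false y) = scons false y.

Lemma zeros_ones m n : zeros m xpredT = zeros n xpredT -> m = n.
Proof.
elim: m n => [|m IH] [|n] // e; first by have := congr1 (@^~ 0) e.
  by have := congr1 (@^~ 0) e.
by congr S; apply: IH; apply: scons_inj e.
Qed.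

(* If [x_0^c] conjugates [h] to an element fixing the left half and [c > 0],
   then [h] fixes the cone of [10], because [x_0^c] maps it into the left half. *)
Lemma fixes_left_quotS s t c :
  0 < c -> fixes_left (x 0 ^+ c * quot 1 s t * x 0 ^- c) ->
  fixes_left (quot 0 s t).
Proof.
case: c => // c _ fixl y.
set z := scons true (scons false y).
have xz : act (x 0 ^+ c.+1) z = zeros c.+1 (scons true y).
  by rewrite expgSr actM actx act_x0X.
have := fixl (zeros c (scons true y)).
rewrite -[scons false (zeros _ _)]xz actM actK actM => /(can_inj (actK _)).
by have [_ ->] := act_quotS 0 s t (scons false y) => /scons_inj.
Qed.

(** The image of 0...0111... shows that the leading exponents agree. If they are positive,
    conjugation makes the tails fix the left half too, so by induction the exponents at index 1
    vanish and index 0 contradicts normality. *)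
Lemma normal_fixes_left s t : normal s t -> fixes_left (quot 0 s t) ->
  head 0%N s = 0%N /\ head 0%N t = 0%N.
Proof.
have [n] := ubnP (size s + size t); elim: n => // n IH in s t *.
move=> le_n nst fixl.
have hst : head 0%N s = head 0%N t.
  have := act_quot_zeros s t xpredT.
  by rewrite /= fixl => /scons_inj/zeros_ones.
have [t0|t_gt0] := posnP (head 0%N t); first by rewrite hst t0.
have fixl' : fixes_left (quot 0 (behead s) (behead t)).
  by apply: (fixes_left_quotS t_gt0); rewrite -{2}hst -quotE.
have [|s1 t1] := IH (behead s) (behead t) _ (normal_behead nst) fixl'.
  by move: t_gt0 le_n; case: (t) => //= *; rewrite size_behead; lia.
have := nst 0; rewrite !nth0 -!nth_behead !nth0 hst t_gt0 s1 t1.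
by [].
Qed.

Lemma act_mul2I a b g h :
  act (a * g * b^-1) =1 act (a * h * b^-1) -> act g =1 act h.
Proof.
move=> e y; have := e (act b y); rewrite !actM !actK.
exact: (can_inj (actK a)).
Qed.

Lemma act_quot_behead s t s' t' c :
  act (quot 0 s t) =1 act (quot 0 s' t') ->
  head 0%N s' = (head 0%N s + c)%N -> head 0%N t' = (head 0%N t + c)%N ->
  act (quot 1 (behead s) (behead t)) =1
  act (x 0 ^+ c * quot 1 (behead s') (behead t') * x 0 ^- c).
Proof.
rewrite !quotE => e hs ht.
apply: (@act_mul2I (x 0 ^+ head 0%N t) (x 0 ^+ head 0%N s)) => y; rewrite e.
by rewrite hs ht (expgnDr _ (head 0%N s)) expgnDr invgM !mulgA.
Qed.

Lemma act_quot_head s t s' t' :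
  act (quot 0 s t) =1 act (quot 0 s' t') ->
  (head 0%N t + head 0%N s' = head 0%N t' + head 0%N s)%N.
Proof.
move=> e; apply/succn_inj/zeros_ones.
have := act_quot_zeros s' t' (zeros (head 0%N s) xpredT).
have := act_quot_zeros s t (zeros (head 0%N s') xpredT).
rewrite -!zerosD -e !addSn (addnC (head 0%N s)) => -> ->.
by [].
Qed.

(** If the leading exponents agree, the tails act alike. If they differ by c > 0, the tail of the
    larger pair fixes the left half by [fixes_left_quotS], so its exponents at index 1 vanish while
    both at index 0 are at least c, against normality. *)
Lemma normal_inj s t s' t' : normal s t -> normal s' t' ->
  act (quot 0 s t) =1 act (quot 0 s' t') ->
  nth 0%N s =1 nth 0%N s' /\ nth 0%N t =1 nth 0%N t'.
Proof.
have [n] := ubnP (size s + size t + (size s' + size t')).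
elim: n => // n IH in s t s' t' *.
wlog le_s : s t s' t' / head 0%N s <= head 0%N s' => [wl|].
  move=> le_n nst nst' e; case/orP: (leq_total (head 0%N s) (head 0%N s')).
    by move=> le_s; apply: wl.
  move=> le_s; have [||es et] := wl s' t' s t le_s _ nst' nst.
  - by rewrite addnC.
  - by move=> y; rewrite e.
  - by split=> m; rewrite ?es ?et.
move=> le_n nst nst' e.
have [|size_gt0] := posnP (size s + size t + (size s' + size t')).
  move/eqP; rewrite !addn_eq0 !size_eq0.
  by move=> /andP[/andP[/eqP-> /eqP->] /andP[/eqP-> /eqP->]].
have hs : head 0%N s' = (head 0%N s + (head 0%N s' - head 0%N s))%N.
  by rewrite subnKC.
have ht : head 0%N t' = (head 0%N t + (head 0%N s' - head 0%N s))%N.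
  by have := act_quot_head e; lia.
have eb := act_quot_behead e hs ht.
have [c0|c_gt0] := posnP (head 0%N s' - head 0%N s).
  have [||||es et] := IH (behead s) (behead t) (behead s') (behead t').
  - by rewrite !size_behead; move: size_gt0 le_n; lia.
  - exact: normal_behead.
  - exact: normal_behead.
  - move: eb; rewrite c0 => eb y.
    apply: (@scons_inj true).
    have [_ <-] := act_quotS 0 (behead s) (behead t) y.
    have [_ <-] := act_quotS 0 (behead s') (behead t') y.
    by rewrite eb expg0 invg1 mulg1 mul1g.
  split=> -[|m]; first by rewrite !nth0 hs c0 addn0.
  - by have := es m; rewrite !nth_behead.
  - by rewrite !nth0 ht c0 addn0.
  - by have := et m; rewrite !nth_behead.
have fixl : fixes_left (quot 0 (behead s') (behead t')).
  apply: (fixes_left_quotS c_gt0) => y; rewrite -eb.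
  by have [] := act_quotS 0 (behead s) (behead t) y.
have [s1 t1] := normal_fixes_left (normal_behead nst') fixl.
have := nst' 0; rewrite !nth0 -!nth_behead !nth0 s1 t1 hs ht !addn_gt0 c_gt0.
by rewrite !orbT.
Qed.

Local Open Scope nat_scope.

(** * Exponents and kinds of carets *)

(* Exponents of the leaves of a subtree [t]: [b] tells whether the root of [t]
   is on the right side, and [n] is the exponent that it would have as a leaf. *)
Fixpoint exps (b : bool) (n : nat) (t : tree) : seq nat :=
  if t is Caret l r then exps false (if b then 0 else n.+1) l ++ exps b 0 r
  else [:: n].

(* [Lft], [Rgt] and [Itr] are the left, right and interior carets. [Nec] only
   occurs as a label, for a non-left caret followed by a leaf of positive
   exponent (the necessary spaces of Belk and Brown's forest diagrams). *)
Variant kind := Lft | Nec | Rgt | Itr.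

Definition nat_of_kind k := match k with Lft => 0 | Nec => 1 | Rgt => 2 | Itr => 3 end.
Definition kind_of_nat n := match n with 0 => Lft | 1 => Nec | 2 => Rgt | _ => Itr end.
Lemma nat_of_kindK : cancel nat_of_kind kind_of_nat. Proof. by case. Qed.
HB.instance Definition _ := Equality.copy kind (can_type nat_of_kindK).

Definition root_kind (a b : bool) : kind :=
  if a then Lft else if b then Rgt else Itr.

(* [a] and [b] tell whether the root of [t] is on the left or right side. *)
Fixpoint kinds (a b : bool) (t : tree) : seq kind :=
  if t is Caret l r then
    kinds a false l ++ root_kind a b :: kinds false b r
  else [::].

Lemma size_exps a b n t : size (exps b n t) = (size (kinds a b t)).+1.
Proof.
elim: t a b n => //= l IHl r IHr a b n.
by rewrite !size_cat /= (IHl a) (IHr false) !addnS.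
Qed.

Lemma exps_head b n t : exps b n t = head 0 (exps b n t) :: behead (exps b n t).
Proof. by have := size_exps false b n t; case: exps. Qed.

Lemma behead_exps b n m t : behead (exps b n t) = behead (exps b m t).
Proof.
elim: t b n m => //= l IHl r IHr b n m.
rewrite (exps_head false (if b then 0 else n.+1)).
rewrite (exps_head false (if b then 0 else m.+1)) /=.
by congr cat; apply: IHl.
Qed.

Lemma head_exps_false n t : head 0 (exps false n t) = n + head 0 (exps false 0 t).
Proof.
elim: t n => [|l IHl r _] n /=; first by rewrite addn0.
rewrite (exps_head _ n.+1) (exps_head _ 1) /=.
by rewrite IHl (IHl 1) addSn addnS.
Qed.

Lemma exps_false n t : exps false n t =
  (n + head 0 (exps false 0 t)) :: behead (exps false 0 t).
Proof. by rewrite exps_head head_exps_false (behead_exps _ n 0). Qed.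

Lemma last_exps b n t : last 0 (exps b n t) = if t is Leaf then n else 0.
Proof.
elim: t b n => //= l _ r IHr b n; rewrite last_cat exps_head /=.
have := IHr b 0; rewrite exps_head /= => ->.
by case: (r).
Qed.

(** Off the right side the exponents form a self-delimiting code: a leaf starts with exactly [n], a
    caret with a larger entry. *)
Lemma exps_catI n t t' u u' :
  exps false n t ++ u = exps false n t' ++ u' -> t = t' /\ u = u'.
Proof.
elim: t t' n u u' => [|l IHl r IHr] [|l' r'] n u u' //=.
- by case=> ->.
- by rewrite (exps_false n.+1) /= => -[]; lia.
- by rewrite (exps_false n.+1) /= => -[]; lia.
- by rewrite -!catA => /IHl[-> /IHr[-> ->]].
Qed.

Definition expo (T : tree) : seq nat := exps true 0 T.

(** On the right side the first entry no longer tells a leaf from a caret, but the length does,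
    since nothing follows. *)
Lemma expo_inj : injective expo.
Proof.
rewrite /expo; elim=> [|l IHl r IHr] [|l' r'] //=.
- by move=> /(congr1 size); rewrite size_cat !(size_exps false) addnS.
- by move=> /(congr1 size); rewrite size_cat !(size_exps false) addnS.
- by move=> /exps_catI[-> /IHr ->].
Qed.

(** * Removing an exposed caret *)

Lemma cat_split2 (T : Type) (u v s1 s2 : seq T) (p q : T) :
  u ++ v = s1 ++ p :: q :: s2 ->
  [\/ exists s2', u = s1 ++ p :: q :: s2' /\ s2 = s2' ++ v,
      exists u' v', [/\ u = rcons u' p, v = q :: v', s1 = u' & s2 = v'] |
      exists s1', v = s1' ++ p :: q :: s2 /\ s1 = u ++ s1'].
Proof.
elim: u s1 => [|a u IH] s1 /=; first by move=> ->; constructor 3; exists s1.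
case: s1 => [|c s1] /= [-> e].
  case: u e {IH} => [|a' u] /=; first by move=> ->; constructor 2; exists [::], s2.
  by case=> -> <-; constructor 1; exists u.
case: (IH _ e) => [[s2' [-> ->]]|[u' [v' [-> -> -> ->]]]|[s1' [-> ->]]].
- by constructor 1; exists s2'.
- by constructor 2; exists (c :: u'), v'.
- by constructor 3; exists s1'.
Qed.

Lemma leaf_of_last b n t u e : exps b n t = rcons u e.+1 -> t = Leaf.
Proof. by move/(congr1 (last 0)); rewrite last_exps last_rcons; case: t. Qed.

(** A positive exponent followed by 0 marks an exposed caret off the right side. It is a left caret
    only if it hangs at the first leaf of a tree rooted on the left side; otherwise it is
    interior. *)
Lemma exps_ungraft a b n t s1 e s2 : b ==> (n == 0) ->
  exps b n t = s1 ++ e.+1 :: 0 :: s2 ->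
  exists2 t', exps b n t' = s1 ++ e :: s2 &
    if a && (s1 == [::]) then kinds a b t = Lft :: kinds a b t' else
    exists k1 k2, [/\ size k1 = size s1, kinds a b t = k1 ++ Itr :: k2 &
                      kinds a b t' = k1 ++ k2].
Proof.
elim: t a b n s1 s2 => [|l IHl r IHr] a b n s1 s2 bn.
  by case: s1 => [|? [|? ?]].
move=> /= e0; case: (cat_split2 e0) => {e0} [[s2' [el ->]]|[u' [v' [el er -> ->]]]|[s1' [er ->]]].
- have [l' el' kl'] := IHl a false _ _ _ isT el.
  exists (Caret l' r); first by rewrite /= el' -catA.
  case: ifP kl' => _ /=; first by move=> ->.
  by move=> [k1 [k2 [sk -> ->]]]; exists k1, (k2 ++ root_kind a b :: kinds false b r);
    rewrite -!catA.
(* The two leaves lie on both sides of the root, so the root itself is the exposed caret. *)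
- have l0 := leaf_of_last el; rewrite l0 /= in el *.
  case: b bn el er => /= [_|_ el er]; first by case: (u') => [|? []].
  case: u' el => [|? [|? ?]] //= [<-].
  have r0 : r = Leaf by case: (r) er => //= l2 r2; rewrite exps_false.
  move: er; rewrite r0 => -[<-].
  exists Leaf => //.
  by case: a => //=; exists [::], [::].
- have [|r' er' kr'] := IHr false b _ _ _ _ er; first by rewrite eqxx implybT.
  exists (Caret l r'); first by rewrite /= er' catA.
  rewrite /= in kr'; case: kr' => k1 [k2 [sk kr kr']].
  have -> : (exps false (if b then 0 else n.+1) l ++ s1' == [::]) = false.
    by rewrite exps_head.
  rewrite andbF; exists (kinds a false l ++ root_kind a b :: k1), k2.
  by rewrite /= kr kr' -!catA !size_cat /= (size_exps a) sk addnS.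
Qed.

(** * Labels of carets *)

(* The kind of each caret, with the exponent of the leaf following it. *)
Definition profile (a b : bool) (t : tree) : seq (kind * nat) :=
  zip (kinds a b t) (behead (exps b 0 t)).

Lemma profile_Caret a b l r : profile a b (Caret l r) =
  profile a false l ++ (root_kind a b, head 0 (exps b 0 r)) :: profile false b r.
Proof.
rewrite /profile /= (exps_head false) /= (behead_exps _ _ 0) (exps_head b 0 r).
rewrite zip_cat //=.
by have := size_exps a false 0 l; rewrite exps_head => -[].
Qed.

Lemma size_behead_exps a b n t : size (behead (exps b n t)) = size (kinds a b t).
Proof. by rewrite size_behead (size_exps a). Qed.

Lemma size_profile a b t : size (profile a b t) = size (kinds a b t).
Proof. by rewrite size1_zip // (size_behead_exps a). Qed.

Lemma unzip1_profile a b t : unzip1 (profile a b t) = kinds a b t.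
Proof. by rewrite unzip1_zip // (size_behead_exps a). Qed.

Lemma unzip2_profile a b t : unzip2 (profile a b t) = behead (exps b 0 t).
Proof. by rewrite unzip2_zip // (size_behead_exps a). Qed.

(** A leaf of positive exponent is the left leaf of the next caret, which is then interior. A leaf
    of exponent 0 either fills an empty right subtree or is the left leaf of a right caret. *)
Definition adjacent (p q : kind * nat) : bool :=
  [&& (0 < p.2) ==> (q.1 == Itr),
      (p.2 == 0) && (p.1 != Itr) ==> (q.1 != Itr) &
      (p.2 == 0) && (p.1 == Rgt) ==> (q.1 == Rgt)].

Lemma kinds_false a t :
  all (fun k => (k == Itr) || a && (k == Lft)) (kinds a false t).
Proof.
elim: t a => //= l IHl r IHr a; rewrite all_cat IHl /=.
apply/andP; split; first by case: a.
by apply: sub_all (IHr false) => k; rewrite orbF => ->.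
Qed.

Lemma head_exps0 t : t = Leaf \/ 0 < head 0 (exps false 0 t).
Proof. by case: t => [|l r]; [left|right]; rewrite //= exps_false. Qed.

Lemma head_kinds b r k ks : kinds false b r = k :: ks ->
  if 0 < head 0 (exps b 0 r) then k = Itr else b /\ k = Rgt.
Proof.
have ff t k' ks' : kinds false false t = k' :: ks' -> k' = Itr.
  by move=> e; have := kinds_false false t; rewrite e /= orbF => /andP[/eqP].
case: b; last first.
  move=> e; rewrite (ff _ _ _ e); case: r e => //= l r _.
  by rewrite exps_false.
case: r => // l r /=; case: (head_exps0 l) => [-> [<-] //|l_gt0].
rewrite (exps_head false 0 l) /= l_gt0.
case e: (kinds false false l) => [|k' ks']; last by case=> <- _; apply: ff e.
by move: l_gt0 e; case: (l) => //= ? ? _ /(congr1 size); rewrite size_cat /= addnS.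
Qed.

Lemma profile_sorted a b t : sorted adjacent (profile a b t).
Proof.
elim: t a b => // l IHl r IHr a b; rewrite profile_Caret sorted_cat_cons.
apply/andP; split.
  have := IHl a false; case/lastP e: (profile a false l) => [|p [k n]] // srt.
  rewrite -!cats1 -catA sorted_cat_cons srt /= andbT.
  have : (k == Itr) || a && (k == Lft).
    have := kinds_false a l; rewrite -unzip1_profile e /unzip1 map_rcons all_rcons.
    by case/andP.
  have /eqP-> : n == 0.
    have := last_exps false 0 l; rewrite exps_head -(unzip2_profile a) e.
    by rewrite /unzip2 map_rcons /= last_rcons => ->; case: (l).
  by case/orP=> [/eqP->//|/andP[-> /eqP->]].
case e: (profile false b r) (IHr false b) => [|[k n] p] //= ->.
have /head_kinds : kinds false b r = k :: unzip1 p by rewrite -unzip1_profile e.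
rewrite andbT /adjacent /=; case: head => [[-> ->]|n' ->] //=.
by case: a.
Qed.

Lemma kinds_true b t : t = Leaf \/ exists ks, kinds true b t = Lft :: ks.
Proof.
elim: t b => [|l IH r _] b; [by left|right] => /=.
by have [->|[ks ->]] := IH false; eexists.
Qed.

Lemma Lft_notin_kinds b t : Lft \notin kinds false b t.
Proof.
elim: t b => //= l IHl r IHr b.
by rewrite mem_cat inE negb_or IHl negb_or IHr andbT; case: b.
Qed.

(** [profile] starts with the leaf after caret 0; this supplies the missing constraint involving
    leaf 0. *)
Lemma second_kind T k1 k2 ks : kinds true true T = k1 :: k2 :: ks ->
  [/\ k1 = Lft, k2 = Rgt -> head 0 (expo T) = 0 & k2 = Lft -> 0 < head 0 (expo T)].
Proof.
case: T => // l r; rewrite /expo /= (exps_head false 0 l) /=.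
have [->|l_gt0] := head_exps0 l.
  move=> /= [<- kr]; split=> // k2L.
  by have := Lft_notin_kinds true r; rewrite kr k2L inE eqxx.
have [l0|[ks' eks]] := kinds_true false l; first by rewrite l0 in l_gt0.
rewrite eks => -[<- e]; split=> // k2R; have := kinds_false true l.
rewrite eks; case: (ks') e => [|k s] /= [kk _]; first by rewrite k2R in kk.
by rewrite kk k2R.
Qed.

(** * The length formula *)

Definition label (p : kind * nat) : kind :=
  if p.1 == Lft then Lft else if 0 < p.2 then Nec else p.1.

Definition labels (T : tree) : seq kind := map label (profile true true T).

(** In each column, [Lft] differs from [Rgt] and from [Nec] by exactly 1, the effect of x_0. Passing
    from [Rgt] to [Itr] changes nothing, except a loss of 2 against [Rgt]; with the new interior
    caret this gives +1 or -1, the effect of x_1^-1. *)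
Definition weight (p : kind * kind) : nat :=
  match p with
  | (Lft, Lft) => 2 | (Lft, _) | (_, Lft) => 1
  | (Nec, _) | (_, Nec) | (Rgt, Rgt) => 2
  | _ => 0
  end.

Arguments weight : simpl never.

Definition right_pair (p : kind * kind) : bool := p == (Rgt, Rgt).

(* Trailing pairs of right carets are free: this makes the cost invariant under
   padding, and corresponds to the type R_0 in Fordham's table. *)
Definition slot (p : kind * kind) (z : seq (kind * kind)) : nat :=
  if right_pair p && all right_pair z then 0 else weight p.

Fixpoint cost (z : seq (kind * kind)) : nat :=
  if z is p :: z' then slot p z' + cost z' else 0.

Arguments profile : simpl never.
Arguments labels : simpl never.

Definition interior (T : tree) : nat := count_mem Itr (kinds true true T).

(* This is the word length plus 2, the extra 2 coming from caret 0, which is a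
   left caret in both trees. *)
Definition total_cost (S T : tree) : nat :=
  interior S + interior T + cost (zip (labels S) (labels T)).

(** [slot] looks ahead, so additivity needs a first part without right pairs. *)
Lemma cost_cat z1 z2 : all (fun p => ~~ right_pair p) z1 ->
  cost (z1 ++ z2) = cost z1 + cost z2.
Proof.
elim: z1 => //= p z1 IH /andP[/negPf pR /IH->].
by rewrite /slot pR /= addnA.
Qed.

Lemma slotE p z : ~~ right_pair p -> slot p z = weight p.
Proof. by rewrite /slot => /negPf->. Qed.

Lemma cost_rcons z : cost (rcons z (Rgt, Rgt)) = cost z.
Proof.
by elim: z => //= p z ->; rewrite /slot all_rcons.
Qed.

Lemma not_right_pair_zip s u : Rgt \notin s ->
  all (fun p => ~~ right_pair p) (zip s u).
Proof.
elim: s u => [|a s IH] [|b u] //=; rewrite inE negb_or => /andP[aR /IH->].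
by rewrite andbT /right_pair xpair_eqE negb_and eq_sym aR.
Qed.

(** Without [Rgt] before the changed position, no earlier slot looks ahead to it. The equation is
    arranged so as to avoid truncated subtraction. *)
Lemma cost_change (a a' : kind) (s1 s2 u : seq kind) : Rgt \notin s1 -> a' != Rgt ->
  size s1 < size u ->
  let b := nth Rgt u (size s1) in let z := zip s2 (drop (size s1).+1 u) in
  cost (zip (s1 ++ a' :: s2) u) + slot (a, b) z =
  cost (zip (s1 ++ a :: s2) u) + weight (a', b).
Proof.
move=> s1R aR ltu /=.
rewrite -(cat_take_drop (size s1) u) (drop_nth Rgt ltu).
have sz : size s1 = size (take (size s1) u) by rewrite size_takel // ltnW.
rewrite !zip_cat //= -(drop_nth _ ltu) cat_take_drop.
rewrite !cost_cat ?not_right_pair_zip //=.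
by rewrite (@slotE (a', _)) ?/right_pair ?xpair_eqE ?negb_and ?aR //; lia.
Qed.

Lemma size_labels T : size (labels T) = size (kinds true true T).
Proof. by rewrite size_map size_profile. Qed.

Lemma labels_spine l m r :
  labels (Caret l (Caret m r)) =
  map label (profile true false l ++
             (Lft, head 0 (exps false 0 m)) :: profile false false m) ++
  label (Rgt, head 0 (exps true 0 r)) :: map label (profile false true r).
Proof.
rewrite /labels !profile_Caret /= (exps_head false 0 m) -map_cons -map_cat.
by rewrite -!catA.
Qed.

Lemma Rgt_notin_labels a t : Rgt \notin map label (profile a false t).
Proof.
apply/mapP => -[[k e] ke]; have : k \in kinds a false t.
  by rewrite -unzip1_profile; apply/mapP; exists (k, e).
move=> /(allP (kinds_false a t)); rewrite /label /=.
by case/orP=> [/eqP->|/andP[_ /eqP->]] //=; case: ifP.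
Qed.

(* The infix number of the right child of the root in [Caret l (Caret m r)]. *)
Definition spine_pos (l m : tree) : nat :=
  (size (kinds true false l) + size (kinds false false m)).+1.

Definition spine_slot (l m r U : tree) :=
  slot (label (Rgt, head 0 (exps true 0 r)), nth Rgt (labels U) (spine_pos l m))
    (zip (map label (profile false true r)) (drop (spine_pos l m).+1 (labels U))).

(** The rotation keeps infix numbers, and only the caret at [spine_pos l m] changes kind, from right
    to left. *)
Lemma cost_rot0 l m r U :
  size (kinds true true (Caret l (Caret m r))) = size (kinds true true U) ->
  total_cost (Caret (Caret l m) r) U + spine_slot l m r U =
  total_cost (Caret l (Caret m r)) U +
    weight (Lft, nth Rgt (labels U) (spine_pos l m)).
Proof.
move=> sz; rewrite /total_cost.
have -> : interior (Caret (Caret l m) r) = interior (Caret l (Caret m r)).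
  by rewrite /interior /= !count_cat /= !count_cat /=; lia.
set s1 := map label (profile true false l ++
             (Lft, head 0 (exps false 0 m)) :: profile false false m).
have s1R : Rgt \notin s1.
  by rewrite /s1 map_cat mem_cat inE !negb_or /= !Rgt_notin_labels.
have ss1 : size s1 = spine_pos l m.
  by rewrite size_map size_cat /= !size_profile addnS.
have ltU : size s1 < size (labels U).
  by rewrite ss1 size_labels -sz /spine_pos /= !size_cat /= !size_cat /=; lia.
have := cost_change (label (Rgt, head 0 (exps true 0 r)))
  (map label (profile false true r)) s1R (isT : Lft != Rgt) ltU.
rewrite /= -labels_spine ss1 -/(spine_slot l m r U).
have -> : s1 ++ Lft :: map label (profile false true r) = labels (Caret (Caret l m) r).
  by rewrite /labels !profile_Caret [RHS]map_cat.
by lia.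
Qed.

(** The caret between [m] and [n] becomes interior, whence the successor. The leaf after it has
    positive exponent exactly when [n] is a caret. *)
Lemma cost_rot1 l m n r U :
  size (kinds true true (Caret l (Caret m (Caret n r)))) = size (kinds true true U) ->
  total_cost (Caret l (Caret (Caret m n) r)) U + spine_slot l m (Caret n r) U =
  total_cost (Caret l (Caret m (Caret n r))) U +
    (weight (if n is Leaf then Itr else Nec, nth Rgt (labels U) (spine_pos l m))).+1.
Proof.
move=> sz; rewrite /total_cost.
have -> : interior (Caret l (Caret (Caret m n) r)) =
          (interior (Caret l (Caret m (Caret n r)))).+1.
  by rewrite /interior /= !count_cat /= !count_cat /= !count_cat /=; lia.
set s1 := map label (profile true false l ++
             (Lft, head 0 (exps false 0 m)) :: profile false false m).
have s1R : Rgt \notin s1.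
  by rewrite /s1 map_cat mem_cat inE !negb_or /= !Rgt_notin_labels.
have ss1 : size s1 = spine_pos l m.
  by rewrite size_map size_cat /= !size_profile addnS.
have ltU : size s1 < size (labels U).
  by rewrite ss1 size_labels -sz /spine_pos /= !size_cat /= !size_cat /=; lia.
set a' := if n is Leaf then Itr else Nec.
have aR : a' != Rgt by rewrite /a'; case: (n).
have := cost_change (label (Rgt, head 0 (exps true 0 (Caret n r))))
  (map label (profile false true (Caret n r))) s1R aR ltU.
cbv zeta; rewrite -labels_spine ss1 -/(spine_slot l m (Caret n r) U).
have -> : s1 ++ a' :: map label (profile false true (Caret n r)) =
    labels (Caret l (Caret (Caret m n) r)).
  rewrite /labels !profile_Caret /s1 !map_cat /= -catA; congr (_ ++ _ :: _).
  rewrite !map_cat /= -!catA /a'; congr (_ ++ _ :: _).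
  by case: (n) => //= ? ?; rewrite exps_false.
by lia.
Qed.

Lemma labels_Caret l r : exists s, labels (Caret l r) = Lft :: s.
Proof.
rewrite /labels /profile; have [//|[ks ->]] := kinds_true true (Caret l r).
have := size_exps true true 0 (Caret l r); case: exps => [|n [|m e]] //=.
  by rewrite size_cat /= addnS.
by eexists.
Qed.

(** Caret 0 of [U'] is left, hence so is caret 1 of [U]. The pair number 0, of weight 2, disappears,
    and the next pair, of weight 1, turns into [(Lft, Lft)], of weight 2. *)
Lemma cost_reduce0 r U U' :
  kinds true true U = Lft :: kinds true true U' ->
  behead (expo U) = 0 :: behead (expo U') -> U' <> Leaf ->
  (total_cost (Caret Leaf r) U').+1 = total_cost (Caret Leaf (Caret Leaf r)) U.
Proof.
move=> kU eU; case: U' kU eU => // l' r' kU eU _.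
have [s' es'] := labels_Caret l' r'.
have lU : labels U = Lft :: labels (Caret l' r').
  by rewrite /labels /profile kU eU.
rewrite /total_cost lU es' /interior kU labels_spine /labels profile_Caret /=.
set a := label (Rgt, _); rewrite !slotE //; last first.
  by rewrite /right_pair xpair_eqE andbF.
have -> : weight (a, Lft) = 1 by rewrite /a /label /=; case: ifP.
have wL k : weight (label (Lft, k), Lft) = 2 by [].
by rewrite !wL; lia.
Qed.

(** The removed pair [(Rgt, Itr)] has weight 0, so only the count of interior carets drops. The
    preceding label of [U] may change, but it faces the root of T_-, and weights against [Lft] do
    not see the difference. *)
Lemma cost_reduce1 l r U U' k1 k2 s1 e s2 :
  size k1 = spine_pos l Leaf -> size s1 = spine_pos l Leaf ->
  kinds true true U = k1 ++ Itr :: k2 -> kinds true true U' = k1 ++ k2 ->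
  expo U = s1 ++ e.+1 :: 0 :: s2 -> expo U' = s1 ++ e :: s2 ->
  (total_cost (Caret l (Caret Leaf r)) U').+1 =
  total_cost (Caret l (Caret Leaf (Caret Leaf r))) U.
Proof.
rewrite /spine_pos addn0 => sk ss kU kU' eU eU'.
case: s1 => [|e0 s1] // in ss eU eU' *.
case/lastP: k1 => [|k1 k] // in sk kU kU' *.
rewrite size_rcons in sk; case: ss => ss; case: sk => sk.
have lU : labels U = map label (zip k1 s1) ++ label (k, e.+1) :: Itr :: map label (zip k2 s2).
  by rewrite /labels /profile kU -/(expo U) eU cat_rcons zip_cat ?sk ?ss // map_cat.
have lU' : labels U' = map label (zip k1 s1) ++ label (k, e) :: map label (zip k2 s2).
  by rewrite /labels /profile kU' -/(expo U') eU' cat_rcons zip_cat ?sk ?ss // map_cat.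
rewrite /total_cost lU lU' /labels !profile_Caret /= !map_cat /=.
have sz : size (map label (profile true false l)) = size (map label (zip k1 s1)).
  by rewrite !size_map size_profile size1_zip ?sk ?ss.
rewrite !zip_cat // !cost_cat ?not_right_pair_zip ?Rgt_notin_labels //=.
have wL e' : weight (Lft, label (k, e')) = weight (Lft, k).
  by rewrite /label; case: (k); case: e'.
have lL : label (Lft, 0) = Lft by [].
rewrite !slotE // lL !wL.
have -> : weight (label (Rgt, 0), Itr) = 0 by [].
rewrite /interior kU kU' /= !count_cat /=.
by lia.
Qed.

(** * Padding *)

(* Padding both trees of a diagram does not change the element. *)
Fixpoint pad (t : tree) : tree :=
  if t is Caret l r then Caret l (pad r) else Caret Leaf Leaf.

Lemma expo_pad t : expo (pad t) = rcons (expo t) 0.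
Proof. by rewrite /expo; elim: t => //= l _ r ->; rewrite rcons_cat. Qed.

Lemma kinds_pad_right t : kinds false true (pad t) = rcons (kinds false true t) Rgt.
Proof. by elim: t => //= l _ r ->; rewrite rcons_cat. Qed.

Lemma kinds_pad t : t <> Leaf -> kinds true true (pad t) = rcons (kinds true true t) Rgt.
Proof. by case: t => //= l r _; rewrite kinds_pad_right rcons_cat. Qed.

Lemma labels_pad t : t <> Leaf -> labels (pad t) = rcons (labels t) Rgt.
Proof.
move=> tN; rewrite /labels /profile kinds_pad // -/(expo _) expo_pad.
have := size_exps true true 0 t; rewrite -/(expo t).
case: (expo t) => [|n s] //= [sz].
by rewrite -!cats1 zip_cat // map_cat.
Qed.

Lemma total_cost_pad S T : S <> Leaf -> T <> Leaf ->
  size (expo S) = size (expo T) -> total_cost (pad S) (pad T) = total_cost S T.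
Proof.
move=> SN TN; rewrite /expo !(size_exps true) => -[sz].
rewrite /total_cost !labels_pad // /interior !kinds_pad //.
rewrite -!cats1 !count_cat zip_cat ?size_labels //= !cats1 cost_rcons.
by rewrite !addn0.
Qed.

(** * Diagrams representing an element *)

Local Open Scope group_scope.

Lemma pos_expsS k n t u :
  pos k (exps false n.+1 t ++ u) = x k * pos k (exps false n t ++ u).
Proof. by rewrite (exps_false n.+1) (exps_false n) /= addSn expgS -mulgA. Qed.

(** Each letter crossed raises the index by 1, and the exponents of a subtree sum to [n] plus its
    number of carets. The index thus stays above the leaf numbers. *)
Lemma x_mul_pos i k n t : (k < i)%N ->
  x i * pos k (exps false n t) =
  pos k (exps false n t) * x (i + n + (size (exps false n t)).-1).
Proof.
elim: t i k n => [|l IHl r IHr] i k n ki /=.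
  by rewrite !mulg1 mul_xX // addn0.
have [ml mr] : (0 < size (exps false n.+1 l) /\ 0 < size (exps false 0 r))%N.
  by rewrite !(size_exps false).
rewrite pos_cat mulgA IHl // -!mulgA; congr (_ * _).
rewrite IHr ?size_cat; last by lia.
by congr (_ * x _); lia.
Qed.

Definition elt (S T : tree) : thompsonF := quot 0 (expo S) (expo T).

Lemma elt_rot0 l m r T :
  elt (Caret (Caret l m) r) T = elt (Caret l (Caret m r)) T * (x 0)^-1.
Proof.
rewrite /elt /quot /expo /= -mulgA; congr (_ * _).
by rewrite -catA pos_expsS invgM.
Qed.

(** In crossing the exponents of [l], x_1 becomes x_j, where j is the number of the first leaf of
    [m]. *)
Lemma elt_rot1 l m n r T :
  elt (Caret l (Caret (Caret m n) r)) T =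
  elt (Caret l (Caret m (Caret n r))) T * (x 1)^-1.
Proof.
rewrite /elt /quot /expo /= -mulgA; congr (_ * _); rewrite -invgM; congr (_^-1).
rewrite -catA !(pos_cat 0 (exps false 0 l)) pos_expsS !mulgA x_mul_pos //.
congr (_ * x _ * _).
have : (0 < size (exps false 0 l))%N by rewrite (size_exps false).
by lia.
Qed.

Lemma elt_pad S T : size (expo S) = size (expo T) -> elt (pad S) (pad T) = elt S T.
Proof. by move=> e; rewrite /elt /quot !expo_pad -!cats1 !pos_cat /= !mulg1. Qed.

Lemma elt_graft S T S' T' s1 e s2 t1 f t2 : size s1 = size t1 ->
  expo S' = s1 ++ e :: s2 -> expo S = s1 ++ e.+1 :: 0%N :: s2 ->
  expo T' = t1 ++ f :: t2 -> expo T = t1 ++ f.+1 :: 0%N :: t2 ->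
  elt S T = elt S' T'.
Proof.
move=> st eS' eS eT' eT; rewrite /elt /quot eS eS' eT eT' !pos_graft st.
by rewrite invgM !mulgA mulgK.
Qed.

Local Open Scope nat_scope.

(** [normal] ignores exposed carets on the right side, so padding is allowed. Excluding [Leaf]
    provides a caret number 0 in both trees. *)
Definition represents (S T : tree) (w : thompsonF) : Prop :=
  [/\ S <> Leaf, T <> Leaf, size (expo S) = size (expo T),
      normal (expo S) (expo T) & elt S T = w].

Lemma size_expo T : size (expo T) = (size (kinds true true T)).+1.
Proof. exact: size_exps. Qed.

Lemma nth_rcons0 s k : nth 0 (rcons s 0) k = nth 0 s k.
Proof. by rewrite nth_rcons; case: ltngtP => [//|lt|->]; rewrite nth_default // ltnW. Qed.

Lemma normal_pad S T : normal (expo S) (expo T) -> normal (expo (pad S)) (expo (pad T)).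
Proof. by move=> nST k; have := nST k; rewrite !expo_pad !nth_rcons0. Qed.

Lemma pad_neq T : pad T <> Leaf. Proof. by case: T. Qed.

Lemma represents_pad S T w : represents S T w -> represents (pad S) (pad T) w.
Proof.
move=> [_ _ sST nST e]; split; try exact: pad_neq.
- by rewrite !expo_pad !size_rcons sST.
- exact: normal_pad.
- by rewrite elt_pad.
Qed.

Lemma represents_iter_pad j S T w : represents S T w ->
  represents (iter j pad S) (iter j pad T) w.
Proof. by move=> rep; elim: j => //= j; apply: represents_pad. Qed.

Lemma expo_iter_pad j T : expo (iter j pad T) = expo T ++ nseq j 0.
Proof.
elim: j => [|j IH]; first by rewrite cats0.
by rewrite iterS expo_pad IH -cats1 -catA -(nseqD j 1) addn1.
Qed.

Lemma total_cost_iter_pad j S T w : represents S T w ->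
  total_cost (iter j pad S) (iter j pad T) = total_cost S T.
Proof.
move=> rep; elim: j => //= j <-.
by have [? ? ? _ _] := represents_iter_pad j rep; apply: total_cost_pad.
Qed.

Lemma expo_pad_eq j T T' : size (expo T) + j = size (expo T') ->
  nth 0 (expo T) =1 nth 0 (expo T') -> T' = iter j pad T.
Proof.
move=> sz e; apply: expo_inj; rewrite expo_iter_pad.
apply: (@eq_from_nth _ 0); first by rewrite size_cat size_nseq.
move=> k _; rewrite -e nth_cat; case: ltnP => // le_k.
by rewrite nth_nseq if_same nth_default.
Qed.

Lemma represents_unique S T S' T' w :
  represents S T w -> represents S' T' w ->
  size (expo S) <= size (expo S') ->
  exists j, S' = iter j pad S /\ T' = iter j pad T.
Proof.
move=> [_ _ sST nST e] [_ _ sST' nST' e'] le.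
have [|eS eT] := normal_inj nST nST'; first by rewrite -/(elt _ _) e -e'.
exists (size (expo S') - size (expo S)).
by split; [apply: expo_pad_eq eS | apply: expo_pad_eq eT]; lia.
Qed.

Lemma total_cost_unique S T S' T' w :
  represents S T w -> represents S' T' w -> total_cost S T = total_cost S' T'.
Proof.
move=> rep rep'; have [le|le] := leqP (size (expo S)) (size (expo S')).
  by have [j [-> ->]] := represents_unique rep rep' le; rewrite (total_cost_iter_pad _ rep).
have [j [-> ->]] := represents_unique rep' rep (ltnW le).
by rewrite (total_cost_iter_pad _ rep').
Qed.

(** * Existence of diagrams *)

Lemma split_expo T k : 0 < nth 0 (expo T) k -> nth 0 (expo T) k.+1 = 0 ->
  exists s1 e s2, size s1 = k /\ expo T = s1 ++ e.+1 :: 0 :: s2.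
Proof.
move=> gt0 eq0; have lt : k.+1 < size (expo T).
  rewrite ltnNge; apply/negP => le; have := last_exps true 0 T.
  rewrite -/(expo T) -nth_last => l0; move: gt0.
  have [->|lt] := eqVneq k (size (expo T)).-1; first by rewrite l0; case: (T).
  by rewrite nth_default //; move: lt le; rewrite size_expo /=; lia.
exists (take k (expo T)), (nth 0 (expo T) k).-1, (drop k.+2 (expo T)).
split; first by rewrite size_takel // ltnW // ltnW.
have -> : 0 :: drop k.+2 (expo T) = drop k.+1 (expo T) by rewrite (drop_nth 0 lt) eq0.
by rewrite prednK // -(drop_nth 0 (ltnW lt)) cat_take_drop.
Qed.

Lemma represents_exists S T : size (expo S) = size (expo T) ->
  exists S' T', represents S' T' (elt S T).
Proof.
have [n] := ubnP (size (expo S)); elim: n => // n IH in S T *.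
move=> le_n sST; have [nST|] := pselect (normal (expo S) (expo T)).
  (* Padding only serves to exclude [Leaf]. *)
  exists (pad S), (pad T); split; try exact: pad_neq.
  - by rewrite !expo_pad !size_rcons sST.
  - exact: normal_pad.
  - by rewrite elt_pad.
move=> /existsNP[k /negP]; rewrite negbK => /and4P[s0 t0 /eqP s1 /eqP t1].
have [a1 [e [a2 [sa eS]]]] := split_expo s0 s1.
have [b1 [f [b2 [sb eT]]]] := split_expo t0 t1.
have [S' eS' _] := exps_ungraft true (isT : true ==> (0 == 0)) eS.
have [T' eT' _] := exps_ungraft true (isT : true ==> (0 == 0)) eT.
rewrite (elt_graft _ eS' eS eT' eT) ?sa ?sb //; apply: IH.
  by move: le_n; rewrite eS /expo eS' !size_cat /=; lia.
by move: sST; rewrite eS eT /expo eS' eT' !size_cat /=; lia.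
Qed.

(** The last leaf of the right side is excluded: a caret grafted there gives the exponents 0, 0. *)
Lemma exps_graft (b : bool) n t s1 e s2 : (b -> s2 != [::]) ->
  exps b n t = s1 ++ e :: s2 ->
  exists t', exps b n t' = s1 ++ e.+1 :: 0 :: s2.
Proof.
elim: t b n s1 s2 => [|l IHl r IHr] b n s1 s2 bs.
  case: s1 => [|? []] //= [<- s2N]; exists (Caret Leaf Leaf).
  by case: b bs => [/(_ isT)|_]; rewrite -s2N.
rewrite /=; set n' := if b then 0 else n.+1; move=> est.
have [lt|ge] := ltnP (size s1) (size (exps false n' l)).
  have [l' el'] : exists l', exps false n' l' =
      s1 ++ e.+1 :: 0 :: drop (size s1).+1 (exps false n' l).
    apply: IHl => //; rewrite -{1}(cat_take_drop (size s1) (exps _ _ _)).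
    rewrite (drop_nth 0 lt); congr (_ ++ _ :: _).
      by have := congr1 (take (size s1)) est; rewrite take_cat lt take_size_cat.
    by have := congr1 (nth 0 ^~ (size s1)) est; rewrite nth_cat lt nth_cat ltnn subnn.
  exists (Caret l' r); rewrite /= -/n' el' -catA /=; congr (_ ++ _ :: _ :: _).
  have := congr1 (drop (size s1).+1) est.
  rewrite -[X in _ = drop _ X]cat_rcons [RHS]drop_size_cat ?size_rcons //.
  rewrite drop_cat; case: ltnP => // le <-.
  by rewrite [drop _ (exps _ _ _)]drop_oversize // (_ : _ - _ = 0) ?drop0 //; lia.
have es1 : s1 = exps false n' l ++ drop (size (exps false n' l)) s1.
  have := congr1 (take (size (exps false n' l))) est.
  by rewrite take_size_cat // takel_cat // => {1}->; rewrite cat_take_drop.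
have := congr1 (drop (size (exps false n' l))) est.
rewrite drop_size_cat // {1}es1 -catA drop_size_cat // => /(IHr _ _ _ _ bs)[r' er'].
by exists (Caret l r'); rewrite /= -/n' er' catA -es1.
Qed.

(** * Right multiplication by generators *)

Lemma nth_update s1 a a' s2 k : nth 0 (s1 ++ a' :: s2) k =
  if k == size s1 then a' else nth 0 (s1 ++ a :: s2) k.
Proof.
rewrite !nth_cat; case: ltngtP => [//|lt|->]; last by rewrite subnn.
by rewrite -(subnSK lt).
Qed.

Lemma nth_catS s1 a s2 : nth 0 (s1 ++ a :: s2) (size s1).+1 = nth 0 s2 0.
Proof. by rewrite -cat_rcons nth_cat size_rcons ltnn subnn. Qed.

(** Only index [size s1] can become bad: at the preceding index the raised entry is one that would
    have to vanish. *)
Lemma normal_incr s1 a s2 t : normal (s1 ++ a :: s2) t ->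
  ~~ [&& 0 < nth 0 t (size s1), nth 0 s2 0 == 0 & nth 0 t (size s1).+1 == 0] ->
  normal (s1 ++ a.+1 :: s2) t.
Proof.
move=> nst c k; have := nst k; rewrite !(nth_update s1 a a.+1).
have [->|_] := eqVneq k (size s1); last first.
  by case: (k.+1 =P size s1) => // _ _; rewrite /= !andbF.
rewrite (gtn_eqF (ltnSn _)) /= => _; apply: contra c.
by rewrite nth_catS.
Qed.

(** The lowered entry may become 0, which could only hurt the preceding index; the exponents of a
    preceding subtree do end with 0. *)
Lemma normal_decr s1 a s2 t : last 0 s1 = 0 ->
  normal (s1 ++ a.+1 :: s2) t -> normal (s1 ++ a :: s2) t.
Proof.
move=> l0 nst k; have := nst k; rewrite !(nth_update s1 a a.+1).
have [->|_] := eqVneq k (size s1).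
  rewrite (gtn_eqF (ltnSn _)) /= => c; apply: contra c => /and4P[_ -> -> ->].
  by [].
have [e _|//] := eqVneq k.+1 (size s1).
by rewrite nth_cat -e ltnSn -[k]/(k.+1.-1) e nth_last l0.
Qed.

Lemma nth_remove s1 a b s2 k : nth 0 (s1 ++ a :: s2) k =
  if k == size s1 then a else nth 0 (s1 ++ b :: 0 :: s2) (k + (size s1 < k)).
Proof.
rewrite !nth_cat; case: (ltngtP k) => [lt|lt|->]; last by rewrite subnn.
  by rewrite addn0 lt.
rewrite addn1 ltnNge leqW 1?ltnW //= -(subnSK lt) /= subSn 1?ltnW //.
by rewrite -(subnSK lt).
Qed.

Lemma normal_remove s1 s2 t1 e t2 : size s1 = size t1 -> last 0 s1 = 0 ->
  normal (s1 ++ 0 :: 0 :: s2) (t1 ++ e.+1 :: 0 :: t2) ->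
  normal (s1 ++ 0 :: s2) (t1 ++ e :: t2).
Proof.
move=> st l0 nst k; rewrite !(nth_remove s1 0 0 s2) !(nth_remove t1 e e.+1 t2) -st.
case: (ltngtP k (size s1)) => [lt|lt|//].
  rewrite addn0; have [ek|neq] := eqVneq k.+1 (size s1).
    by rewrite [nth 0 (s1 ++ _) k]nth_cat lt -[k]/(k.+1.-1) ek nth_last l0.
  by rewrite [size s1 < _]ltnNge lt !addn0; apply: nst.
rewrite (gtn_eqF (leqW lt)) ltnS (ltnW lt) /= !addn1; exact: nst.
Qed.

Lemma last_exps0 b t : last 0 (exps b 0 t) = 0.
Proof. by rewrite last_exps; case: t. Qed.

(** Only the exponent of leaf 0 is raised, so index 0 is the only obstruction; normality of the old
    pair there gives [l = Leaf]. *)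
Lemma step0 l m r U w : represents (Caret l (Caret m r)) U w ->
  represents (Caret (Caret l m) r) U (w * (x 0)^-1)%g \/
  [/\ l = Leaf, m = Leaf, 0 < nth 0 (expo U) 0 & nth 0 (expo U) 1 = 0].
Proof.
move=> [_ UN sU nU e].
have eS : expo (Caret l (Caret m r)) = [::] ++ head 0 (exps false 0 l) ::
    (behead (exps false 0 l) ++ exps false 0 m ++ exps true 0 r).
  by rewrite {1}/expo /= {1}exps_head.
have eS' : expo (Caret (Caret l m) r) = [::] ++ (head 0 (exps false 0 l)).+1 ::
    (behead (exps false 0 l) ++ exps false 0 m ++ exps true 0 r).
  by rewrite /expo /= (exps_false 1) catA.
set c := [&& 0 < nth 0 (expo U) 0, 
  nth 0 (behead (exps false 0 l) ++ exps false 0 m ++ exps true 0 r) 0 == 0 &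
  nth 0 (expo U) 1 == 0].
have [/and3P[U0 s1 /eqP U1]|nc] := boolP c.
  right; have := nU 0; rewrite eS U0 /= s1 U1 !andbT -eqn0Ngt => /eqP l0.
  have [lL|] := head_exps0 l; last by rewrite l0.
  split=> //; have [//|] := head_exps0 m.
  by move: s1; rewrite lL /= exps_head /= => /eqP->.
left; split=> //.
- by rewrite -sU eS eS' !size_cat.
- by rewrite eS'; apply: normal_incr; rewrite -?eS.
- by rewrite elt_rot0 e.
Qed.

Lemma represents_spine_neq l r U : size (expo (Caret l r)) = size (expo U) -> U <> Leaf.
Proof. by move=> + UL; rewrite UL !size_expo /= size_cat /= addnS. Qed.

Lemma reduce0 r U w : represents (Caret Leaf (Caret Leaf r)) U w ->
  0 < nth 0 (expo U) 0 -> nth 0 (expo U) 1 = 0 ->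
  exists2 U', represents (Caret Leaf r) U' (w * (x 0)^-1)%g &
    (total_cost (Caret Leaf r) U').+1 = total_cost (Caret Leaf (Caret Leaf r)) U.
Proof.
move=> [_ UN sU nU e] U0 U1.
have [s1 [f [s2 [ss eU]]]] := split_expo U0 U1.
case: s1 ss eU => // _ eU.
have [U' eU' kU] := exps_ungraft true (isT : true ==> (0 == 0)) eU.
rewrite /= in kU.
have eS : expo (Caret Leaf (Caret Leaf r)) = [::] ++ 0 :: 0 :: exps true 0 r by [].
have sU' : size (expo (Caret Leaf r)) = size (expo U').
  by move: sU; rewrite eU eS /expo eU' /=; lia.
have U'N := represents_spine_neq sU'.
exists U'; last first.
  by apply: cost_reduce0; rewrite // eU /expo eU'.
split=> //.
- rewrite /expo eU' /=; apply: (@normal_remove [::] (exps true 0 r) [::]) => //.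
  by rewrite -eS -eU.
- rewrite -e -elt_rot0; symmetry.
  by apply: (elt_graft (s1 := [::]) (t1 := [::]) _ _ _ eU' eU).
Qed.

Lemma spine_posE l : spine_pos l Leaf = size (exps false 0 l).
Proof. by rewrite /spine_pos addn0 (size_exps true). Qed.

Lemma step1 l m n r U w (p := spine_pos l Leaf) :
  represents (Caret l (Caret m (Caret n r))) U w ->
  represents (Caret l (Caret (Caret m n) r)) U (w * (x 1%N)^-1)%g \/
  [/\ m = Leaf, n = Leaf, 0 < nth 0 (expo U) p & nth 0 (expo U) p.+1 = 0].
Proof.
move=> [_ UN sU nU e]; rewrite /p spine_posE.
set t := behead (exps false 0 m) ++ exps false 0 n ++ exps true 0 r.
have eS : expo (Caret l (Caret m (Caret n r))) =
    exps false 0 l ++ head 0 (exps false 0 m) :: t.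
  by rewrite {1}/expo /= {1}(exps_head _ _ m).
have eS' : expo (Caret l (Caret (Caret m n) r)) =
    exps false 0 l ++ (head 0 (exps false 0 m)).+1 :: t.
  by rewrite /expo /= (exps_false 1) /t -!catA.
set c := [&& 0 < nth 0 (expo U) (size (exps false 0 l)), nth 0 t 0 == 0 &
  nth 0 (expo U) (size (exps false 0 l)).+1 == 0].
have [/and3P[U0 s1 /eqP U1]|nc] := boolP c.
  right; have := nU (size (exps false 0 l)).
  rewrite eS U0 U1 nth_catS s1 nth_cat ltnn subnn /=.
  rewrite andbT -eqn0Ngt => /eqP m0.
  have [mL|] := head_exps0 m; last by rewrite m0.
  split=> //; have [//|] := head_exps0 n.
  by move: s1; rewrite /t mL /= exps_head /= => /eqP->.
left; split=> //.
- by rewrite -sU eS eS' !size_cat.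
- by rewrite eS'; apply: normal_incr; rewrite -?eS.
- by rewrite elt_rot1 e.
Qed.

Lemma reduce1 l r U w (p := spine_pos l Leaf) :
  represents (Caret l (Caret Leaf (Caret Leaf r))) U w ->
  0 < nth 0 (expo U) p -> nth 0 (expo U) p.+1 = 0 ->
  exists2 U', represents (Caret l (Caret Leaf r)) U' (w * (x 1%N)^-1)%g &
    (total_cost (Caret l (Caret Leaf r)) U').+1 =
    total_cost (Caret l (Caret Leaf (Caret Leaf r))) U.
Proof.
move=> [_ UN sU nU e] U0 U1.
have [s1 [f [s2 [ss eU]]]] := split_expo U0 U1.
have [U' eU' kU] := exps_ungraft true (isT : true ==> (0 == 0)) eU.
have s1N : s1 == [::] = false by case: (s1) ss.
rewrite /= s1N in kU; case: kU => k1 [k2 [sk kU kU']].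
have sU' : size (expo (Caret l (Caret Leaf r))) = size (expo U').
  by move: sU; rewrite eU /expo eU' /= !size_cat /=; lia.
have U'N := represents_spine_neq sU'.
exists U'; last first.
  by apply: cost_reduce1 kU kU' eU eU'; rewrite ?sk.
have ssl : size (exps false 0 l) = size s1 by rewrite -spine_posE.
split=> //.
- rewrite /expo eU' /=; apply: normal_remove; rewrite ?last_exps0 //.
  by rewrite -eU.
- rewrite -e -elt_rot1; symmetry.
  by apply: (elt_graft ssl _ _ eU' eU); rewrite /expo.
Qed.

Lemma split0 l m r U w : represents (Caret (Caret l m) r) U w ->
  represents (Caret l (Caret m r)) U (w * x 0)%g.
Proof.
move=> [_ UN sU nU e]; split=> //.
- by rewrite -sU /expo /= (exps_false 1) (exps_head _ _ l) /= !size_cat addnA.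
- rewrite /expo /= (exps_head _ _ l) /=.
  apply: (@normal_decr [::]) => //.
  by move: nU; rewrite /expo /= (exps_false 1) /= -catA.
- by rewrite -e elt_rot0 mulgVK.
Qed.

Lemma split1 l m n r U w : represents (Caret l (Caret (Caret m n) r)) U w ->
  represents (Caret l (Caret m (Caret n r))) U (w * x 1%N)%g.
Proof.
move=> [_ UN sU nU e]; split=> //.
- rewrite -sU /expo /= (exps_false 1) (exps_head _ _ m) /= !size_cat /= !size_cat.
  by rewrite addnA.
- rewrite /expo /= (exps_head _ _ m) /=.
  apply: normal_decr; first exact: last_exps0.
  by move: nU; rewrite /expo /= (exps_false 1) /= -!catA.
- by rewrite -e elt_rot1 mulgVK.
Qed.

Lemma pad3 S : exists l m n r, iter 3 pad S = Caret l (Caret m (Caret n r)).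
Proof. by case: S => [|l [|m [|n r]]] /=; do 4!eexists. Qed.

Lemma label_right n r : label (Rgt, head 0 (exps true 0 (Caret n r))) =
  if n is Leaf then Rgt else Nec.
Proof. by rewrite /label /=; case: n => //= ? ?; rewrite exps_false. Qed.

(** * Each generator changes the total cost by at most 1 *)

Lemma weight_rot0 a b z : a = Rgt \/ a = Nec ->
  slot (a, b) z <= (weight (Lft, b)).+1 /\ weight (Lft, b) <= (slot (a, b) z).+1.
Proof.
by rewrite /slot /right_pair xpair_eqE => -[->|->]; case: b; case: all.
Qed.

Lemma label_right_or e : label (Rgt, e) = Rgt \/ label (Rgt, e) = Nec.
Proof. by rewrite /label /=; case: e; [left|right]. Qed.

Lemma weight_rot1 b z :
  slot (Rgt, b) z <= (weight (Itr, b)).+2 /\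
  weight (Itr, b) <= slot (Rgt, b) z.
Proof.
by rewrite /slot /right_pair xpair_eqE; case: b; case: all.
Qed.

Lemma size_kinds_eq S T w : represents S T w ->
  size (kinds true true S) = size (kinds true true T).
Proof. by move=> [_ _ + _ _]; rewrite !size_expo => -[]. Qed.

Lemma cost_dist0 S T S' T' w :
  represents S T w -> represents S' T' (w * (x 0)^-1)%g ->
  total_cost S' T' <= (total_cost S T).+1 /\ total_cost S T <= (total_cost S' T').+1.
Proof.
move=> rep rep'; rewrite -(total_cost_iter_pad 3 rep).
have {rep} := represents_iter_pad 3 rep.
have [l [m [n [r ->]]]] := pad3 S; set U := iter 3 pad T => rep.
have [rep2|[l0 m0 U0 U1]] := step0 rep; last first.
  rewrite l0 m0 in rep *; have [U' rep2 e] := reduce0 rep U0 U1.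
  by rewrite (total_cost_unique rep' rep2); lia.
rewrite (total_cost_unique rep' rep2).
have := cost_rot0 (size_kinds_eq rep); rewrite /spine_slot.
by have [] := weight_rot0 (nth Rgt (labels U) (spine_pos l m))
  (zip (map label (profile false true (Caret n r))) (drop (spine_pos l m).+1 (labels U)))
  (label_right_or (head 0 (exps true 0 (Caret n r)))); lia.
Qed.

Lemma cost_dist1 S T S' T' w :
  represents S T w -> represents S' T' (w * (x 1%N)^-1)%g ->
  total_cost S' T' <= (total_cost S T).+1 /\ total_cost S T <= (total_cost S' T').+1.
Proof.
move=> rep rep'; rewrite -(total_cost_iter_pad 3 rep).
have {rep} := represents_iter_pad 3 rep.
have [l [m [n [r ->]]]] := pad3 S; set U := iter 3 pad T => rep.
have [rep2|[m0 n0 U0 U1]] := step1 rep; last first.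
  rewrite m0 n0 in rep *; have [U' rep2 e] := reduce1 rep U0 U1.
  by rewrite (total_cost_unique rep' rep2); lia.
rewrite (total_cost_unique rep' rep2).
have := cost_rot1 (size_kinds_eq rep); rewrite /spine_slot label_right.
set b := nth _ _ _; set z := zip _ _; case: (n) => [|n1 n2].
  by have [] := weight_rot1 b z; lia.
by rewrite slotE //; lia.
Qed.

Lemma expo_graft T k : k.+1 < size (expo T) ->
  exists T', expo T' = take k (expo T) ++ (nth 0 (expo T) k).+1 :: 0 :: drop k.+1 (expo T).
Proof.
move=> lt; apply: (@exps_graft true 0 T) => [_|].
  by rewrite -size_eq0 size_drop -lt0n subn_gt0.
by rewrite -drop_nth ?cat_take_drop // ltnW.
Qed.

(** The same leaf of both trees receives a caret. The pair becomes unreduced, but T_- gains the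
    caret that x_0 or x_1 is to take apart. *)
Lemma graft_both S S1 T w s1 e s2 : represents S T w ->
  expo S = s1 ++ e :: s2 -> expo S1 = s1 ++ e.+1 :: 0 :: s2 -> s2 != [::] ->
  exists2 T1, size (expo S1) = size (expo T1) & elt S1 T1 = w.
Proof.
move=> [_ _ sz _ <-] eS eS1 s2N.
have lt : (size s1).+1 < size (expo T).
  by rewrite -sz eS size_cat /= -addn1 ltn_add2l ltnS lt0n size_eq0.
have [T1 eT1] := expo_graft lt; exists T1.
  by move: sz; rewrite eS1 eS eT1 !size_cat /= size_takel 1?ltnW 1?ltnW // size_drop; lia.
apply: (elt_graft _ eS eS1 _ eT1); first by rewrite size_takel // ltnW // ltnW.
by rewrite -drop_nth ?cat_take_drop // ltnW.
Qed.

Lemma represents_mulx0 S T w : represents S T w ->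
  exists S' T', represents S' T' (w * x 0)%g.
Proof.
move=> rep; case: S rep => [[]//|[|l m] r] rep; last first.
  by exists (Caret l (Caret m r)), T; apply: split0.
have [||T' sz <-] := graft_both (S1 := Caret (Caret Leaf Leaf) r)
  (s1 := [::]) (e := 0) (s2 := exps true 0 r) rep (erefl _); first by [].
  by rewrite exps_head.
rewrite elt_rot0 mulgVK.
by apply: represents_exists; move: sz; rewrite /expo.
Qed.

Lemma represents_mulx1 S T w : represents S T w ->
  exists S' T', represents S' T' (w * x 1%N)%g.
Proof.
move=> /(represents_iter_pad 3); move: (iter 3 pad T) => {}T.
have [l [[|m1 m2] [n [r ->]]]] := pad3 S => rep; last first.
  by exists (Caret l (Caret m1 (Caret m2 (Caret n r)))), T; apply: split1.
have [||T' sz <-] := graft_both (S1 := Caret l (Caret (Caret Leaf Leaf) (Caret n r)))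
  (s1 := exps false 0 l) (e := 0) (s2 := exps true 0 (Caret n r)) rep (erefl _);
  first by [].
  by rewrite /= (exps_head _ _ n).
rewrite elt_rot1 mulgVK.
by apply: represents_exists; move: sz; rewrite /expo /= !size_cat.
Qed.

Lemma represents_mulVx0 S T w : represents S T w ->
  exists S' T', represents S' T' (w * (x 0)^-1)%g.
Proof.
move=> /(represents_iter_pad 3); move: (iter 3 pad T) => {}T.
have [l [m [n [r ->]]]] := pad3 S => -[_ _ sz _ <-].
rewrite -elt_rot0; apply: represents_exists.
by rewrite -sz /expo /= (exps_false 1) (exps_head _ _ l) /= !size_cat /=; lia.
Qed.

Lemma represents_mulVx1 S T w : represents S T w ->
  exists S' T', represents S' T' (w * (x 1%N)^-1)%g.
Proof.
move=> /(represents_iter_pad 3); move: (iter 3 pad T) => {}T.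
have [l [m [n [r ->]]]] := pad3 S => -[_ _ sz _ <-].
rewrite -elt_rot1; apply: represents_exists.
rewrite -sz /expo /= (exps_false 1) (exps_head _ _ m) /= !size_cat /= !size_cat /=.
by lia.
Qed.

Lemma represents_gen S T w a : a \in gens -> represents S T w ->
  exists S' T', [/\ represents S' T' (w * a)%g,
    total_cost S' T' <= (total_cost S T).+1 & total_cost S T <= (total_cost S' T').+1].
Proof.
rewrite !inE => /or4P[] /eqP-> rep.
- have [S' [T' rep']] := represents_mulx0 rep; exists S', T'.
  have rep2 : represents S T (w * x 0 * (x 0)^-1)%g by rewrite mulgK.
  by have [] := cost_dist0 rep' rep2.
- have [S' [T' rep']] := represents_mulVx0 rep; exists S', T'.
  by have [] := cost_dist0 rep rep'.
- have [S' [T' rep']] := represents_mulx1 rep; exists S', T'.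
  have rep2 : represents S T (w * x 1%N * (x 1%N)^-1)%g by rewrite mulgK.
  by have [] := cost_dist1 rep' rep2.
- have [S' [T' rep']] := represents_mulVx1 rep; exists S', T'.
  by have [] := cost_dist1 rep rep'.
Qed.

Lemma represents1 : represents (Caret Leaf Leaf) (Caret Leaf Leaf) 1%g.
Proof.
split=> //; first by case=> [|[|k]] /=; rewrite ?nth_nil.
by rewrite /elt /quot -[expo _]/(nseq 2 0) !pos_nseq0 mulgV.
Qed.

Lemma cost_le_product n w S T : is_product n w -> represents S T w ->
  total_cost S T <= n + 2.
Proof.
move=> [s [<- sg <-]].
suff [S' [T' [rep' le]]] : exists S' T',
    represents S' T' (\prod_(a <- s) a)%g /\ total_cost S' T' <= size s + 2.
  by move=> rep; rewrite (total_cost_unique rep rep').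
elim/last_ind: s sg => [_|s a IH sg].
  by exists (Caret Leaf Leaf), (Caret Leaf Leaf); rewrite big_nil; split; first exact: represents1.
have [b bs|S' [T' [rep' le]]] := IH; first by apply: sg; rewrite mem_rcons inE bs orbT.
have ag : a \in gens by apply: sg; rewrite mem_rcons inE eqxx.
have [S2 [T2 [rep2 le2 _]]] := represents_gen ag rep'.
exists S2, T2; rewrite -cats1 big_cat big_seq1 size_cat /=; split=> //.
by lia.
Qed.

(** * Kinds, exponents and labels by caret number *)

Definition kind_at (T : tree) (k : nat) : kind := nth Rgt (kinds true true T) k.
Definition exp_at (T : tree) (k : nat) : nat := nth 0 (expo T) k.
Definition label_at (T : tree) (k : nat) : kind := nth Rgt (labels T) k.

Lemma nth_profile T k : k < size (kinds true true T) ->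
  nth (Rgt, 0) (profile true true T) k = (kind_at T k, exp_at T k.+1).
Proof.
move=> lt; rewrite nth_zip ?(size_behead_exps true) // nth_behead.
by [].
Qed.

Lemma label_atE T k : k < size (kinds true true T) -> label_at T k = label (kind_at T k, exp_at T k.+1).
Proof.
by move=> lt; rewrite -nth_profile // -(nth_map _ Rgt) ?size_profile.
Qed.

Lemma Nec_notin_kinds a b t : Nec \notin kinds a b t.
Proof.
elim: t a b => //= l IHl r IHr a b.
by rewrite mem_cat inE !negb_or IHl IHr andbT; case: a; case: b.
Qed.

Lemma kind_at_neq_Nec T k : kind_at T k != Nec.
Proof.
have [lt|ge] := ltnP k (size (kinds true true T)); last by rewrite /kind_at nth_default.
by apply: contraNneq (Nec_notin_kinds true true T) => <-; apply: mem_nth.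
Qed.

Lemma adjacentP T k : k.+1 < size (kinds true true T) ->
  adjacent (kind_at T k, exp_at T k.+1) (kind_at T k.+1, exp_at T k.+2).
Proof.
move=> lt; rewrite -(nth_profile lt) -(nth_profile (ltnW lt)).
by have /(sortedP (Rgt, 0)) := profile_sorted true true T; apply; rewrite size_profile.
Qed.

Lemma kind_at_next_Itr T k : k.+1 < size (kinds true true T) -> 0 < exp_at T k.+1 ->
  kind_at T k.+1 = Itr.
Proof. by move=> /adjacentP/and3P[+ _ _] e0; rewrite /= e0 => /eqP. Qed.

Lemma kind_at_next_Rgt T k : k.+1 < size (kinds true true T) -> label_at T k = Rgt ->
  kind_at T k.+1 = Rgt.
Proof.
move=> lt; rewrite label_atE 1?ltnW // /label /=.
case: eqP => // _; case: ltnP => //; rewrite leqn0 => /eqP e0 kR.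
by have /and3P[_ _ /=] := adjacentP lt; rewrite e0 kR => /eqP.
Qed.

Lemma label_at_Rgt_or T k : k < size (kinds true true T) -> kind_at T k = Rgt ->
  label_at T k = Rgt \/ label_at T k = Nec.
Proof. by move=> lt kR; rewrite label_atE // kR; apply: label_right_or. Qed.

Lemma label_at_Nec T k : k < size (kinds true true T) -> label_at T k = Nec -> 0 < exp_at T k.+1.
Proof.
move=> lt; rewrite label_atE // /label /=; case: eqP => // _; case: ltnP => // _ e.
by have := kind_at_neq_Nec T k; rewrite e eqxx.
Qed.

Lemma label_at_Itr T k : k < size (kinds true true T) -> label_at T k = Itr ->
  kind_at T k = Itr /\ exp_at T k.+1 = 0.
Proof. by move=> lt; rewrite label_atE // /label /=; case: eqP => // _; case: posnP. Qed.

Lemma label_at_Lft T k : k < size (kinds true true T) -> label_at T k = Lft -> kind_at T k = Lft.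
Proof. by move=> lt; rewrite label_atE // /label /=; case: eqP => // _; case: posnP. Qed.

Lemma label_at_Rgt T k : k < size (kinds true true T) -> label_at T k = Rgt ->
  kind_at T k = Rgt /\ exp_at T k.+1 = 0.
Proof. by move=> lt; rewrite label_atE // /label /=; case: eqP => // _; case: posnP. Qed.

Lemma kind_at1 T : 1 < size (kinds true true T) ->
  [/\ kind_at T 0 = Lft, kind_at T 1 = Rgt -> exp_at T 0 = 0 & kind_at T 1 = Lft -> 0 < exp_at T 0].
Proof.
rewrite /kind_at /exp_at nth0; case e: kinds => [|k1 [|k2 ks]] //= _.
exact: second_kind e.
Qed.

(** * The word length *)

(** Past the last caret [label_at] defaults to [Rgt], so this describes the tail that [slot] makes
    free. *)
Definition right_from (S T : tree) (p : nat) : Prop :=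
  forall k, p <= k -> label_at S k = Rgt /\ label_at T k = Rgt.

Lemma label_at_spine l m r i : label_at (Caret l (Caret m r)) (spine_pos l m + i) =
  nth Rgt (label (Rgt, head 0 (exps true 0 r)) :: map label (profile false true r)) i.
Proof.
have sz : size (map label (profile true false l ++
    (Lft, head 0 (exps false 0 m)) :: profile false false m)) = spine_pos l m.
  by rewrite size_map size_cat /= !size_profile addnS.
by rewrite /label_at labels_spine nth_cat sz ltnNge leq_addr /= addKn.
Qed.

Lemma spine_pos_lt l m r : spine_pos l m < size (kinds true true (Caret l (Caret m r))).
Proof. by rewrite /spine_pos /= size_cat /= size_cat /=; lia. Qed.

Lemma spine_slotP l m r U (S := Caret l (Caret m r)) (d := spine_pos l m) :
  size (kinds true true S) = size (kinds true true U) ->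
  (right_from S U d /\ spine_slot l m r U = 0) \/
  (~ right_from S U d /\ spine_slot l m r U = weight (label_at S d, label_at U d)).
Proof.
move=> sz; have ltU : d < size (labels U).
  by rewrite size_labels -sz spine_pos_lt.
have eS : label_at S d = label (Rgt, head 0 (exps true 0 r)).
  by have := label_at_spine l m r 0; rewrite addn0.
rewrite /spine_slot -/d -eS -/(label_at U d).
set s := map label (profile false true r); set t := drop d.+1 (labels U).
have eqP_from : right_pair (label_at S d, label_at U d) && all right_pair (zip s t) <->
    right_from S U d.
  have st : size s = size t.
    rewrite size_drop size_labels -sz size_map size_profile /d /spine_pos /=.
    by rewrite size_cat /= size_cat /=; lia.
  have nS i : label_at S (d + i.+1) = nth Rgt s i by rewrite label_at_spine.
  have nU i : label_at U (d + i.+1) = nth Rgt t i by rewrite nth_drop /label_at addnS.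
  rewrite /right_pair xpair_eqE; split.
    move=> /andP[/andP[/eqP Sd /eqP Ud] /(all_nthP (Rgt, Rgt)) al] k.
    rewrite leq_eqVlt => /orP[/eqP<-//|lt].
    have -> : k = d + (k - d.+1).+1 by lia.
    rewrite nS nU; have [lti|gei] := ltnP (k - d.+1) (size s); last first.
      by rewrite !nth_default // -st.
    have := al (k - d.+1); rewrite size1_zip ?st // -st => /(_ lti).
    by rewrite nth_zip // xpair_eqE => /andP[/eqP-> /eqP->].
  move=> rf; have [-> ->] := rf d (leqnn d); rewrite !eqxx /=.
  apply/(all_nthP (Rgt, Rgt)) => i _; rewrite nth_zip // xpair_eqE -nS -nU.
  by have [|-> ->] := rf (d + i.+1); rewrite ?leq_addr ?eqxx.
rewrite /slot; case: ifP => c; [left|right]; split=> //.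
  by apply/eqP_from.
by move/eqP_from; rewrite c.
Qed.

Lemma label_at_spine0 l m r : label_at (Caret l (Caret m r)) (spine_pos l m) =
  label (Rgt, head 0 (exps true 0 r)).
Proof. by have := label_at_spine l m r 0; rewrite addn0. Qed.

Lemma label_at_spine_shift l m l' m' r k : spine_pos l m = (spine_pos l' m').+1 ->
  spine_pos l m <= k ->
  label_at (Caret l (Caret m r)) k = label_at (Caret l' (Caret m' (Caret Leaf r))) k.
Proof.
move=> e le; have -> : k = spine_pos l m + (k - spine_pos l m) by lia.
by rewrite label_at_spine e addSnnS label_at_spine profile_Caret.
Qed.

Lemma right_from_exp_at T p : (forall k, p <= k -> label_at T k = Rgt) ->
  forall k, p < k -> exp_at T k = 0.
Proof.
move=> rf [//|k] pk; have [lt|ge] := ltnP k (size (kinds true true T)).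
  by have [] := label_at_Rgt lt (rf k pk).
by rewrite /exp_at nth_default // size_expo.
Qed.

Lemma pos_exp_at0 T : (forall k, exp_at T k = 0) -> pos 0 (expo T) = 1%g.
Proof.
move=> e0; have -> : expo T = nseq (size (expo T)) 0; last exact: pos_nseq0.
apply: (@eq_from_nth _ 0); first by rewrite size_nseq.
by move=> k _; rewrite nth_nseq if_same; apply: e0.
Qed.

(** * Some generator lowers the cost of a nontrivial element *)

Definition descends (S T : tree) (w : thompsonF) : Prop :=
  exists2 a, a \in gens & exists S' T',
    represents S' T' (w * a)%g /\ total_cost S' T' < total_cost S T.

Lemma gens0 : x 0 \in gens. Proof. by rewrite !inE eqxx. Qed.
Lemma gensV0 : (x 0)^-1%g \in gens. Proof. by rewrite !inE eqxx ?orbT. Qed.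
Lemma gens1 : x 1%N \in gens. Proof. by rewrite !inE eqxx ?orbT. Qed.
Lemma gensV1 : (x 1%N)^-1%g \in gens. Proof. by rewrite !inE eqxx ?orbT. Qed.

Lemma descend_rot0 l m r U w (S := Caret l (Caret m r)) (d := spine_pos l m) :
  represents S U w -> ~ right_from S U d ->
  weight (Lft, label_at U d) < weight (label_at S d, label_at U d) -> descends S U w.
Proof.
move=> rep nrf lt; exists (x 0)^-1%g; first exact: gensV0.
have [rep'|[l0 m0 U0 U1]] := step0 rep; last first.
  move: rep; rewrite /S l0 m0 => rep; have [U' rep' e] := reduce0 rep U0 U1.
  by exists (Caret Leaf r), U'; split=> //; lia.
exists (Caret (Caret l m) r), U; split=> //.
have := cost_rot0 (size_kinds_eq rep).
have [[//]|[_ ->]] := spine_slotP (size_kinds_eq rep).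
by move: lt; rewrite -/S -/d -/(label_at U d); lia.
Qed.

(** Outside the free tail, replacing [Nec] by [Lft] fails to gain only against [Lft], and replacing
    [Rgt] by [Lft] only against [Lft] and [Itr]. *)
Lemma descend_step0 l m n r U w (S := Caret l (Caret m (Caret n r)))
    (d := spine_pos l m) :
  represents S U w -> descends S U w \/
  [\/ label_at S d = Nec /\ label_at U d = Lft, n = Leaf /\ label_at U d = Itr,
      n = Leaf /\ label_at U d = Lft | right_from S U d].
Proof.
move=> rep; have [rf|nrf] := pselect (right_from S U d).
  by right; constructor 4.
have := @descend_rot0 _ _ _ _ _ rep nrf; rewrite -/S -/d.
have nL : label_at S d = if n is Leaf then Rgt else Nec.
  by rewrite label_at_spine0 label_right.
case eU : (label_at U d); case: (n) nL => [|n1 n2] -> dsc; try by left; apply: dsc.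
- by right; constructor 3.
- by right; constructor 1.
- by right; constructor 2.
Qed.

(** Splitting loses an interior caret; this gain is outweighed only when [Itr] becomes [Rgt] against
    a [Rgt] outside the free tail. *)
Lemma descend_split1 l c1 c2 r U w :
  represents (Caret l (Caret (Caret c1 c2) r)) U w ->
  descends (Caret l (Caret (Caret c1 c2) r)) U w \/
  [/\ c2 = Leaf, label_at U (spine_pos l c1) = Rgt &
      ~ right_from (Caret l (Caret c1 (Caret c2 r))) U (spine_pos l c1)].
Proof.
move=> rep; have rep' := split1 rep; have cst := cost_rot1 (size_kinds_eq rep').
have dsc : total_cost (Caret l (Caret c1 (Caret c2 r))) U <
    total_cost (Caret l (Caret (Caret c1 c2) r)) U ->
    descends (Caret l (Caret (Caret c1 c2) r)) U w.
  by move=> lt; exists (x 1%N); [apply: gens1 | do 2!eexists; split; first exact: rep'].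
case: c2 => [|c2 c3] in rep rep' cst dsc *; last first.
  left; apply: dsc; move: cst; rewrite /spine_slot label_right slotE //.
  by rewrite /label_at; lia.
have [[rf e0]|[nrf e0]] := spine_slotP (size_kinds_eq rep').
  left; apply: dsc; move: cst; rewrite e0.
  by have [_] := rf _ (leqnn _); rewrite /label_at => ->; rewrite /weight; lia.
move: cst; rewrite e0 label_at_spine0 label_right -/(label_at U _).
case eU : (label_at U _) => cst; try by left; apply: dsc; rewrite /weight in cst; lia.
by right.
Qed.

(** If x_1 fails, the next caret of [U] is right too, so the pair at the next spine caret consists
    of [Rgt] or [Nec], with weight 2, and x_0^-1 gains. *)
Lemma descent_split1 l c1 c2 n r U w :
  represents (Caret l (Caret (Caret c1 c2) (Caret n r))) U w ->
  descends (Caret l (Caret (Caret c1 c2) (Caret n r))) U w.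
Proof.
move=> rep; have [//|[c0 eU nrf]] := descend_split1 rep.
move: rep nrf; rewrite {}c0 => rep nrf.
have szU := size_kinds_eq rep.
have ed : spine_pos l (Caret c1 Leaf) = (spine_pos l c1).+1.
  by rewrite /spine_pos /= size_cat /= addn1 addnS.
have ltd := spine_pos_lt l (Caret c1 Leaf) (Caret n r).
rewrite szU ed in ltd.
have kU := kind_at_next_Rgt ltd eU.
(* A free tail starting here would extend back over the preceding pair of right labels. *)
have nrf' : ~ right_from (Caret l (Caret (Caret c1 Leaf) (Caret n r))) U
    (spine_pos l (Caret c1 Leaf)).
  rewrite ed => rf; apply: nrf => k; rewrite leq_eqVlt => /orP[/eqP<-|lt].
    by rewrite label_at_spine0 label_right.
  by have [+ ->] := rf k lt; split=> //; rewrite -(label_at_spine_shift _ ed) // ed.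
apply: descend_rot0 => //; rewrite label_at_spine0 ed.
have := label_at_Rgt_or ltd kU.
have := label_right_or (head 0 (exps true 0 (Caret n r))).
case=> e [] eU'; rewrite e eU' //.
Qed.

(** Splitting the root by x_0 gains unless [U] has [Nec] or [Rgt] there. After [Nec], either x_0^-1
    gains or x_1^-1 produces a cancelling caret; after [Rgt], x_0^-1 gains. *)
Lemma descent_split0 l1 l2 n r U w :
  represents (Caret (Caret l1 l2) (Caret Leaf (Caret n r))) U w ->
  descends (Caret (Caret l1 l2) (Caret Leaf (Caret n r))) U w.
Proof.
move=> rep; have rep' := split0 rep; have cst := cost_rot0 (size_kinds_eq rep').
have dsc : total_cost (Caret l1 (Caret l2 (Caret Leaf (Caret n r)))) U <
    total_cost (Caret (Caret l1 l2) (Caret Leaf (Caret n r))) U ->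
    descends (Caret (Caret l1 l2) (Caret Leaf (Caret n r))) U w.
  by move=> lt; exists (x 0); [apply: gens0 | do 2!eexists; split; first exact: rep'].
have [//|rest] := descend_step0 rep.
have ltd := spine_pos_lt (Caret l1 l2) Leaf (Caret n r).
rewrite (size_kinds_eq rep) in ltd.
have ed : spine_pos (Caret l1 l2) Leaf = (spine_pos l1 l2).+1.
  by rewrite /spine_pos /= size_cat /=; lia.
rewrite ed in rest ltd.
have ltb := ltnW ltd.
have [[rf e0]|[nrf e0]] := spine_slotP (size_kinds_eq rep').
  apply: dsc; move: cst; rewrite e0.
  by have [_] := rf _ (leqnn _); rewrite /label_at => ->; rewrite /weight; lia.
move: cst; rewrite e0 label_at_spine0 label_right -/(label_at U _).
case eU : (label_at U _) => cst; try by apply: dsc; rewrite /weight in cst; lia.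
  (* The caret after the root is interior and exposed in [U]. *)
  have ex_gt0 := label_at_Nec ltb eU.
  have kI := kind_at_next_Itr ltd ex_gt0.
  have [n0 e1] : n = Leaf /\ exp_at U (spine_pos l1 l2).+2 = 0.
    case: rest => [[_ e]|[-> e]|[_ e]|rf].
    - by have := label_at_Lft ltd e; rewrite kI.
    - by have [_] := label_at_Itr ltd e.
    - by have := label_at_Lft ltd e; rewrite kI.
    - by have [_ e] := rf _ (leqnn _); have [] := label_at_Rgt ltd e; rewrite kI.
  move: rep; rewrite n0 => rep.
  have [||U' rep2 lt] := reduce1 rep; rewrite ?ed //.
  exists (x 1%N)^-1%g; first exact: gensV1.
  by do 2!eexists; split; [exact: rep2 | lia].
have kR := kind_at_next_Rgt ltd eU.
case: rest => [[_ e]|[_ e]|[_ e]|rf].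
- by have := label_at_Lft ltd e; rewrite kR.
- by have [] := label_at_Itr ltd e; rewrite kR.
- by have := label_at_Lft ltd e; rewrite kR.
- case: nrf => k; rewrite leq_eqVlt => /orP[/eqP<-|lt].
    by rewrite label_at_spine0 label_right.
  by have [+ ->] := rf k lt; split=> //; rewrite -(label_at_spine_shift _ ed) // ed.
Qed.

(** If x_0^-1 does not gain by its weight, caret 1 of [U] is left and x_0^-1 cancels, or it is
    interior and x_1^-1 cancels, or all exponents vanish and [w] is trivial. *)
Lemma descent_Leaf n r U w :
  represents (Caret Leaf (Caret Leaf (Caret n r))) U w -> w <> 1%g ->
  descends (Caret Leaf (Caret Leaf (Caret n r))) U w.
Proof.
move=> rep w1; have [//|rest] := descend_step0 rep.
have ltd := spine_pos_lt Leaf Leaf (Caret n r).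
rewrite (size_kinds_eq rep) /spine_pos /= in ltd rest.
have [k0 kR kL] := kind_at1 ltd.
have e1 : kind_at U 1 != Itr -> exp_at U 1 = 0.
  by move=> kN; apply/eqP; rewrite -[_ == _]negbK -lt0n; apply: contra kN => /(kind_at_next_Itr ltd)/eqP.
have red0 : label_at U 1 = Lft -> descends (Caret Leaf (Caret Leaf (Caret n r))) U w.
  move=> /(label_at_Lft ltd) e.
  have [||U' rep2 lt] := reduce0 rep; [exact: kL | by apply: e1; rewrite e |].
  exists (x 0)^-1%g; first exact: gensV0.
  by do 2!eexists; split; [exact: rep2 | lia].
case: rest => [[_ /red0]|[n0 e]|[_ /red0]|rf] //.
  have [kI e2] := label_at_Itr ltd e.
  move: rep; rewrite n0 => rep.
  have [||U' rep2 lt] := reduce1 rep; rewrite ?spine_posE //.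
    rewrite lt0n; apply/negP => /eqP e0.
    by have /and3P[_ + _] := adjacentP ltd; rewrite k0 kI /= [exp_at U 1]e0.
  exists (x 1%N)^-1%g; first exact: gensV1.
  by do 2!eexists; split; [exact: rep2 | lia].
have [_ labU] := rf 1 isT; have [kU _] := label_at_Rgt ltd labU.
case: w1; have [_ _ _ _ <-] := rep.
rewrite /elt /quot !pos_exp_at0 ?mulgV // => -[|[|k]] //.
- by apply: (@right_from_exp_at _ 1) => // j /rf[].
- exact: kR.
- by apply: e1; rewrite kU.
- by apply: (@right_from_exp_at _ 1) => // j /rf[].
Qed.

Lemma descent S T w : represents S T w -> w <> 1%g -> descends S T w.
Proof.
move=> rep0 w1.
suff : descends (iter 3 pad S) (iter 3 pad T) w.
  by rewrite /descends (total_cost_iter_pad 3 rep0).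
have {rep0} := represents_iter_pad 3 rep0; move: (iter 3 pad T) => U.
have [l [m [n [r ->]]]] := pad3 S.
case: m => [|c1 c2]; last exact: descent_split1.
case: l => [|l1 l2]; last exact: descent_split0.
by move/descent_Leaf; apply.
Qed.

Lemma total_cost1 S T : represents S T 1%g -> total_cost S T = 2.
Proof. by move/total_cost_unique/(_ represents1). Qed.

Lemma cost_ge_product S T w : represents S T w ->
  exists n, is_product n w /\ n + 2 <= total_cost S T.
Proof.
have [k] := ubnP (total_cost S T); elim: k => // k IH in S T w *.
move=> le_k rep; have [w1|/eqP w1] := eqVneq w 1%g.
  exists 0; rewrite w1 in rep *; rewrite (total_cost1 rep); split=> //.
  by exists [::]; rewrite big_nil.
have [a ag [S' [T' [rep' lt]]]] := descent rep w1.
have [||n [pn le]] := IH S' T' (w * a)%g; [by lia | by [] |].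
exists (n + 1); split; last by lia.
have aVg : a^-1%g \in gens.
  by move: ag; rewrite !inE => /or4P[]/eqP->; rewrite ?invgK eqxx ?orbT.
by have := is_productM pn (is_product1 aVg); rewrite mulgK.
Qed.

Lemma wlength_cost S T w : represents S T w -> wlength w + 2 = total_cost S T.
Proof.
move=> rep; rewrite /wlength; case: ex_minnP => m /asboolP pm min_m.
have [n [pn le]] := cost_ge_product rep.
have := cost_le_product pm rep; have : m <= n by apply: min_m; apply/asboolP.
by lia.
Qed.

(** * Vertices of a tree *)

(* The exponent of a leaf, computed by following its address from the root. *)
Fixpoint walk (b : bool) (n : nat) (v : vertex) : nat :=
  if v is c :: v' then
    if c then walk b 0 v' else walk false (if b then 0 else n.+1) v'
  else n.

Lemma exps_walk b n t : exps b n t = map (walk b n) (leaves t).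
Proof.
elim: t b n => //= l IHl r IHr b n.
by rewrite IHl IHr map_cat -!map_comp.
Qed.

Lemma walk_rcons b n v c : walk b n (rcons v c) =
  if c then 0 else if b && on_right_side v then 0 else (walk b n v).+1.
Proof.
elim: v b n => [|a v IH] b n /=; first by case: c; case: b.
by case: a; rewrite IH ?andbF.
Qed.

Lemma left_path_rcons v c n : left_path (rcons v c) n.+1 =
  [&& ~~ c, left_path v n & ~~ on_right_side v].
Proof.
rewrite /left_path size_rcons subSS /= -cats1.
have [le|lt] := leqP n (size v); last first.
  have -> : size v - n = 0 by lia.
  rewrite !drop0 /=; have -> : v == nseq n false = false.
    by apply/eqP => /(congr1 size) e; rewrite e size_nseq ltnn in lt.
  rewrite andbF; apply/negP => /andP[/eqP/(congr1 size)/= e _].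
  by move: e lt; rewrite size_cat size_nseq addn1 => -[->]; rewrite ltnn.
rewrite drop_cat take_cat; have [ltn|ge] := ltnP (size v - n) (size v); last first.
  have -> : n = 0 by lia.
  rewrite subn0 subnn take0 drop0 cats0 take_size drop_size.
  by case: c; rewrite /= ?eqxx ?andbT.
have -> : n == 0 = false by apply/eqP; lia.
have -> : false :: nseq n false = nseq n false ++ [:: false].
  by rewrite -(nseqD n 1) addn1.
rewrite orFb eqseq_cat; last first.
  by rewrite size_drop size_nseq subKn.
rewrite /= eqseq_cons eqxx andbT eqbF_neg.
case: c => /=; rewrite ?andbF // ?andbT -?andbA; apply: andb_id2l => /eqP e.
apply/idP/andP => [H|[] //]; split=> //.
apply: contra H => vR; move: vR; rewrite /on_right_side -{1}(cat_take_drop (size v - n) v) all_cat.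
by case/andP.
Qed.

Lemma left_path0 v : left_path v 0.
Proof. by rewrite /left_path subn0 drop_size. Qed.

Lemma left_path_walk v n : left_path v n -> n <= walk true 0 v.
Proof.
elim/last_ind: v n => [|v c IH] [|n] //.
by rewrite left_path_rcons walk_rcons => /and3P[/negPf-> /IH le /negPf->].
Qed.

Lemma walk_left_path v : left_path v (walk true 0 v).
Proof.
elim/last_ind: v => [|v c IH] //; rewrite walk_rcons /=.
case: c => /=; first exact: left_path0.
case: ifP => [_|vR]; first exact: left_path0.
by rewrite left_path_rcons IH vR.
Qed.

Lemma exponentE T k : k < size (leaves T) -> exponent T k = exp_at T k.
Proof.
move=> lt; rewrite /exponent /exp_at /expo exps_walk (nth_map [::]) //.
set v := nth _ _ _; apply/eqP; rewrite eqn_leq; apply/andP; split.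
  by apply/bigmax_leqP => n /left_path_walk.
have vs : walk true 0 v < (size v).+1.
  have := walk_left_path v; rewrite /left_path => /andP[/eqP/(congr1 size)].
  by rewrite size_drop size_nseq => <- _; rewrite ltnS leq_subr.
exact: (@leq_bigmax_cond _ (fun n : 'I_(size v).+1 => left_path v n)
  (fun n => n : nat) (Ordinal vs) (walk_left_path v)).
Qed.

Lemma size_leaves T : size (leaves T) = size (expo T).
Proof. by rewrite /expo exps_walk size_map. Qed.

Lemma size_kinds a b t : size (kinds a b t) = size (carets t).
Proof.
elim: t a b => //= l IHl r IHr a b.
by rewrite !size_cat /= !size_map IHl IHr.
Qed.

Lemma prod_pos (e : nat -> nat) k n :
  (\prod_(i <- iota k n) x i ^+ e i)%g = pos k (map e (iota k n)).
Proof.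
by elim: n k => [|n IH] k; rewrite ?big_nil //= big_cons IH.
Qed.

Lemma element_elt S T : same_carets (S, T) -> element (S, T) = elt S T.
Proof.
rewrite /same_carets /= -!(size_kinds true true) => sz.
have sS : size (leaves S) = size (expo T) by rewrite size_leaves !size_expo sz.
have expoE R : size (leaves R) = size (expo T) ->
    map (exponent R) (iota 0 (size (expo T))) = expo R.
  move=> sR; apply: (@eq_from_nth _ 0); rewrite size_map size_iota -sR ?size_leaves //.
  move=> i lt; rewrite (nth_map 0) ?size_iota // nth_iota // add0n exponentE //.
  by rewrite size_leaves.
have e : (size (leaves S)).-1.+1 = size (expo T) by rewrite sS size_expo.
rewrite /element -[(S, T).1]/S -[(S, T).2]/T e prod_pos expoE ?size_leaves //.
congr (_ * _)%g; rewrite -(expoE S) // -prod_pos.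
elim: (iota _ _) => [|k s IH]; first by rewrite !big_nil invg1.
by rewrite rev_cons -cats1 big_cat big_seq1 big_cons invgM -IH.
Qed.

Lemma uniq_leaves t : uniq (leaves t).
Proof.
elim: t => //= l IHl r IHr.
rewrite cat_uniq !map_inj_uniq ?IHl ?IHr //=; try by move=> u v [].
by rewrite andbT; apply/hasPn => v /mapP[u _ ->]; apply/mapP => -[].
Qed.

Lemma uniq_carets t : uniq (carets t).
Proof.
elim: t => //= l IHl r IHr.
rewrite cat_uniq /= !map_inj_uniq ?IHl ?IHr //=; try by move=> u v [].
rewrite andbT negb_or -andbA; apply/and3P; split.
- by apply/mapP => -[].
- by apply/hasPn => v /mapP[u _ ->]; apply/mapP => -[].
- by apply/mapP => -[].
Qed.

Lemma mem_caretsL l r v : (false :: v \in carets (Caret l r)) = (v \in carets l).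
Proof.
rewrite /= mem_cat inE /= mem_map; last by move=> ? ? [].
by case: (_ \in carets l) => //=; apply/mapP => -[].
Qed.

Lemma mem_caretsR l r v : (true :: v \in carets (Caret l r)) = (v \in carets r).
Proof.
rewrite /= mem_cat inE /= mem_map; last by move=> ? ? [].
by rewrite orbC; case: (_ \in carets r) => //=; apply/mapP => -[].
Qed.

Lemma mem_carets0 l r : [::] \in carets (Caret l r).
Proof. by rewrite /= mem_cat inE eqxx orbT. Qed.

Lemma infix_number0 l r : infix_number (Caret l r) [::] = size (carets l).
Proof.
rewrite /infix_number /= index_cat size_map; case: ifP => [/mapP[]//|_].
by rewrite /= addn0.
Qed.

Lemma infix_numberL l r v : v \in carets l ->
  infix_number (Caret l r) (false :: v) = infix_number l v.
Proof.
move=> vl; rewrite /infix_number /= index_cat map_f // index_map //.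
by move=> ? ? [].
Qed.

Lemma infix_numberR l r v :
  infix_number (Caret l r) (true :: v) = (size (carets l) + infix_number r v).+1.
Proof.
rewrite /infix_number /= index_cat size_map; case: ifP => [/mapP[]//|_].
by rewrite /= index_map ?addnS // => ? ? [].
Qed.

Lemma exposed_leaves b n t s1 e s2 : b ==> (n == 0) ->
  exps b n t = s1 ++ e.+1 :: 0 :: s2 ->
  exists2 v, v \in carets t & exists q1 q2,
    leaves t = q1 ++ rcons v false :: rcons v true :: q2 /\ size q1 = size s1.
Proof.
elim: t b n s1 s2 => [|l IHl r IHr] b n s1 s2 bn.
  by case: s1 => [|? [|? ?]].
move=> /= e0; case: (cat_split2 e0) => {e0} [[s2' [el _]]|[u' [v' [el er -> _]]]|[s1' [er ->]]].
- have [//|v vl [q1 [q2 [-> <-]]]] := IHl false _ _ _ _ el.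
  exists (false :: v); first by rewrite -/(carets (Caret l r)) mem_caretsL.
  exists (map (cons false) q1), (map (cons false) q2 ++ map (cons true) (leaves r)).
  by rewrite map_cat -catA size_map.
- have l0 := leaf_of_last el; rewrite l0 /= in el *.
  case: b bn el er => /= [_|_ el er]; first by case: (u') => [|? []].
  case: u' el => [|? [|? ?]] //= _.
  have -> : r = Leaf by case: (r) er => //= l2 r2; rewrite exps_false.
  by exists [::] => //; exists [::], [::].
- have [|v vr [q1 [q2 [-> sq]]]] := IHr b 0 _ _ _ er; first by rewrite eqxx implybT.
  exists (true :: v); first by rewrite -/(carets (Caret l r)) mem_caretsR.
  exists (map (cons false) (leaves l) ++ map (cons true) q1), (map (cons true) q2).
  rewrite map_cat -catA !size_cat !size_map sq; split=> //.
  by rewrite exps_walk size_map.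
Qed.

Lemma exposed_caretP T m : 0 < exp_at T m -> exp_at T m.+1 = 0 -> exposed_caret T m.
Proof.
move=> m0 m1; have [s1 [e [s2 [<- eT]]]] := split_expo m0 m1.
have [//|v vT [q1 [q2 [eq sq]]]] := @exposed_leaves true 0 T s1 e s2 _ eT.
have uq := uniq_leaves T; exists v => //; rewrite /leaf_number.
have lL : nth [::] (leaves T) (size s1) = rcons v false by rewrite eq -sq nth_cat ltnn subnn.
have lR : nth [::] (leaves T) (size s1).+1 = rcons v true.
  by rewrite eq -sq -cat_rcons nth_cat size_rcons ltnn subnn.
have sz : (size s1).+1 < size (leaves T) by rewrite eq size_cat sq /=; lia.
split.
- by rewrite -lL mem_nth // ltnW.
- by rewrite -lL index_uniq // ltnW.
- by rewrite -lR mem_nth.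
- by rewrite -lR index_uniq.
Qed.

Lemma kinds_carets a b t : kinds a b t =
  [seq root_kind (a && on_left_side v) (b && on_right_side v) | v <- carets t].
Proof.
elim: t a b => //= l IHl r IHr a b.
rewrite IHl IHr map_cat /= !andbT -!map_comp; congr (_ ++ _ :: _).
  by apply: eq_map => v /=; rewrite andbF.
by apply: eq_map => v /=; rewrite andbF.
Qed.

Lemma left_caret_child T v : v \in carets T -> on_left_side v ->
  infix_number T v <> 0 -> rcons v false \in carets T.
Proof.
elim: T v => // l IH r _ [|[] v] //.
  by rewrite infix_number0 mem_caretsL; case: (l) => //= ? ?; rewrite mem_carets0.
rewrite /= -/(carets (Caret l r)) !mem_caretsL => vl vL.
by rewrite infix_numberL // => /(IH _ vl vL).
Qed.

(** Exponent 0 makes the left subtree of the right child empty, so caret k+1 is that child and caret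
    k+2 lies in its right subtree. *)
Lemma right_caret_child a t k : k.+2 < size (kinds a true t) ->
  nth Lft (kinds a true t) k = Rgt -> nth 0 (exps true 0 t) k.+1 = 0 ->
  exists v, [/\ v \in carets t, on_right_side v, a ==> (v != [::]),
    infix_number t v = k & [/\ rcons v true \in carets t, infix_number t (rcons v true) = k.+1,
    rcons (rcons v true) false \notin carets t & rcons (rcons v true) true \in carets t]].
Proof.
elim: t a k => // l _ r IHr a k.
rewrite [kinds a true (Caret l r)]/= [exps true 0 _]/=.
move en : (size (kinds a false l)) => n.
have sn : size (carets l) = n by rewrite -en size_kinds.
rewrite size_cat en [size (_ :: _)]/= => lt.
have [ltk|] := ltnP k n.
  rewrite nth_cat en ltk => e; rewrite -en in ltk.
  have /allP/(_ _ (mem_nth Lft ltk)) := kinds_false a l.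
  by rewrite e andbF.
rewrite leq_eqVlt => /orP[/eqP nk|ltk].
  rewrite -{}nk in lt *; rewrite nth_cat en ltnn subnn nth_cat (size_exps a) en ltnn subnn nth0 [nth _ _ _]/=.
  case: a {en} => // _ e.
  case: r IHr lt e => [|r1 r2] _ lt; first by move: lt; rewrite /=; lia.
  have [r10 _|gt0] := head_exps0 r1; last first.
    by rewrite /= (exps_head _ _ r1) /=; case: head gt0.
  have r2N : r2 <> Leaf by move=> r20; move: lt; rewrite r10 r20 /=; lia.
  rewrite r10; exists [::]; split; rewrite ?mem_carets0 ?infix_number0 //.
  rewrite -[rcons [::] true]/[:: true] infix_numberR infix_number0 sn addn0.
  rewrite !mem_caretsR mem_carets0 mem_caretsL; split=> //.
  by case: r2 r2N {lt} => // r3 r4 _; rewrite mem_carets0.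
have -> : k = (n + (k - n.+1)).+1 by lia.
set j := k - n.+1; rewrite !nth_cat (size_exps a) en.
have -> : ((n + j).+1 < n) = false by lia.
have -> : ((n + j).+2 < n.+1) = false by lia.
have -> : (n + j).+1 - n = j.+1 by lia.
have -> : (n + j).+2 - n.+1 = j.+1 by lia.
move=> kj ej; have [|v [vr vR _ vj [w1 w2 w3 w4]]] := IHr false j _ kj ej; first by lia.
exists (true :: v); split; rewrite ?mem_caretsR ?infix_numberR ?vj ?sn ?implybT //.
by split=> //; rewrite [infix_number _ _]w2 addnS.
Qed.

(** * Dead ends *)

Lemma dead_end_neq1 w : dead_end w -> w <> 1%g.
Proof.
move=> de w1; have := wlength_cost represents1; have := de _ gens0.
by rewrite w1 (total_cost1 represents1); lia.
Qed.

Lemma expo_Leaf T : size (expo T) = 1 -> T = Leaf.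
Proof. by case: T => // l r; rewrite size_expo /= size_cat /= addnS. Qed.

Lemma represents_reduced w S T : w <> 1%g -> reduced_diagram w (S, T) ->
  represents S T w.
Proof.
move=> w1 [sc e]; have /eqP/negPf-> := w1 => nu.
have sz : size (expo S) = size (expo T).
  by rewrite !size_expo !size_kinds; congr _.+1.
have eST : elt S T = w by rewrite -element_elt.
have eN : S = Leaf -> T = Leaf -> False.
  by move=> S0 T0; apply: w1; rewrite -eST S0 T0 /elt /quot mulgV.
split=> //.
- by move=> S0; apply: (eN S0); apply: expo_Leaf; rewrite -sz S0.
- by move=> T0; apply: eN => //; apply: expo_Leaf; rewrite sz T0.
- move=> m; apply/negP => /and4P[s0 t0 /eqP s1 /eqP t1]; apply: nu; exists m.
  by split; apply: exposed_caretP.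
Qed.

Lemma total_cost_dead S T S' T' w a : dead_end w -> a \in gens ->
  represents S T w -> represents S' T' (w * a)%g ->
  (total_cost S' T').+1 = total_cost S T.
Proof.
move=> de ag rep rep'; have := de a ag.
by rewrite -(wlength_cost rep) -(wlength_cost rep') => <-.
Qed.

Lemma iter_pad_Caret j l r : iter j pad (Caret l r) = Caret l (iter j pad r).
Proof. by elim: j => //= j ->. Qed.

Lemma represents_left_eq l r T l' r' T' w :
  represents (Caret l r) T w -> represents (Caret l' r') T' w ->
  l = l' /\ exists j, r' = iter j pad r \/ r = iter j pad r'.
Proof.
move=> rep rep'; case/orP: (leq_total (size (expo (Caret l r))) (size (expo (Caret l' r')))).
  move/(represents_unique rep rep') => [j [+ _]]; rewrite iter_pad_Caret => -[-> ->].
  by split=> //; exists j; left.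
move/(represents_unique rep' rep) => [j [+ _]]; rewrite iter_pad_Caret => -[-> ->].
by split=> //; exists j; right.
Qed.

(** An x_0^-1 move leads from [w * x 0] back to [w]. Without cancellation it leaves a caret on the
    left; with cancellation it would lower the cost, making [w] shorter than [w * x 0]. *)
Lemma dead_end_left l r T w : dead_end w -> represents (Caret l r) T w ->
  exists l1 l2, l = Caret l1 l2.
Proof.
move=> de rep; have [S' [T' rep']] := represents_mulx0 rep.
have {rep'} := represents_iter_pad 3 rep'; move: (iter 3 pad T') => U.
have [l' [m' [n' [r' ->]]]] := pad3 S' => rep'.
have cst := total_cost_dead de gens0 rep rep'.
have [|[l0 m0 U0 U1]] := step0 rep'.
  by rewrite mulgK => /(represents_left_eq rep)[-> _]; do 2!eexists.
rewrite l0 m0 in rep' cst; have [U' rep2 e] := reduce0 rep' U0 U1.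
by rewrite mulgK in rep2; have := total_cost_unique rep rep2; lia.
Qed.

Lemma dead_end_middle l m r T w : dead_end w -> represents (Caret l (Caret m r)) T w ->
  exists m1 m2, m = Caret m1 m2.
Proof.
move=> de rep; have [S' [T' rep']] := represents_mulx1 rep.
have {rep'} := represents_iter_pad 3 rep'; move: (iter 3 pad T') => U.
have [l' [m' [n' [r' ->]]]] := pad3 S' => rep'.
have cst := total_cost_dead de gens1 rep rep'.
have [|[m0 n0 U0 U1]] := step1 rep'.
  rewrite mulgK => /(represents_left_eq rep)[_ [j []]]; rewrite iter_pad_Caret => -[].
    by move=> <- _; do 2!eexists.
  by move=> -> _; do 2!eexists.
rewrite m0 n0 in rep' cst; have [U' rep2 e] := reduce1 rep' U0 U1.
by rewrite mulgK in rep2; have := total_cost_unique rep rep2; lia.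
Qed.

(** Since the tree after the root is nonempty, x_0 turns the label of the root from [Lft] into
    [Nec], which gains only against [Lft]. *)
Lemma dead_end_root l1 l2 m1 m2 r U w : dead_end w ->
  represents (Caret (Caret l1 l2) (Caret (Caret m1 m2) r)) U w ->
  label_at U (spine_pos l1 l2) = Lft.
Proof.
move=> de rep; have rep' := split0 rep.
have := cost_rot0 (size_kinds_eq rep'); rewrite /spine_slot label_right slotE //.
rewrite -(total_cost_dead de gens0 rep rep') -/(label_at U _).
by case: (label_at U _); rewrite /weight => // e; exfalso; lia.
Qed.

(** A nonempty [m] excludes cancellation. As x_1^-1 adds an interior caret, the pair at d must lose
    2, which only [Rgt] turning into [Itr] against a non-free [Rgt] does. *)
Lemma dead_end_right l m1 m2 n r U w (m := Caret m1 m2) : dead_end w ->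
  represents (Caret l (Caret m (Caret n r))) U w ->
  [/\ n = Leaf, label_at U (spine_pos l m) = Rgt &
      ~ right_from (Caret l (Caret m (Caret n r))) U (spine_pos l m)].
Proof.
move=> de rep; have [rep'|[] //] := step1 rep.
have := cost_rot1 (size_kinds_eq rep).
rewrite -(total_cost_dead de gensV1 rep rep') -/(label_at U _).
have [[_ ->]|[nrf ->]] := spine_slotP (size_kinds_eq rep); first by lia.
rewrite label_at_spine0 label_right.
by case: n rep rep' nrf => [|n1 n2] rep rep' nrf; case: (label_at U _);
  rewrite /weight => e; try (exfalso; lia); split.
Qed.

Lemma label_at_iter_pad j T k : T <> Leaf -> label_at (iter j pad T) k = label_at T k.
Proof.
move=> TN; elim: j => //= j <-; rewrite /label_at labels_pad; last by case: j => // j; apply: pad_neq.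
by rewrite nth_rcons; case: ltngtP => // [lt|->]; rewrite nth_default // ltnW.
Qed.

Lemma label_at_default T k : size (kinds true true T) <= k -> label_at T k = Rgt.
Proof. by move=> le; rewrite /label_at nth_default // size_labels. Qed.

(** The last leaf has exponent 0, so a right caret at the very end is labelled [Rgt] and not
    [Nec]. *)
Lemma label_at_right_end T d : label_at T d = Rgt -> size (kinds true true T) <= d.+2 ->
  forall k, d <= k -> label_at T k = Rgt.
Proof.
move=> dR le k; rewrite leq_eqVlt => /orP[/eqP<-//|].
rewrite leq_eqVlt => /orP[/eqP<-|lt]; last by apply: label_at_default; lia.
have [lt1|] := ltnP d.+1 (size (kinds true true T)); last exact: label_at_default.
have sz : size (kinds true true T) = d.+2 by lia.
rewrite label_atE // (kind_at_next_Rgt lt1 dR).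
have -> : exp_at T d.+2 = 0; last by [].
have := last_exps0 true T; rewrite -nth_last -/(expo T) size_expo sz.
by [].
Qed.

Lemma dead_end_form_minus l1 l2 m1 m2 r : r <> Leaf ->
  form_minus (Caret (Caret l1 l2) (Caret (Caret m1 m2) (Caret Leaf r))).
Proof.
move=> rN; split; first by split; rewrite /vb /va /vd ?mem_caretsL ?mem_caretsR mem_carets0.
- by rewrite /vc mem_caretsR mem_caretsL mem_carets0.
- by rewrite /ve !mem_caretsR mem_carets0.
- by rewrite -[rcons _ _]/[:: true; true; false] !mem_caretsR mem_caretsL.
- rewrite -[rcons _ _]/[:: true; true; true] !mem_caretsR.
  by case: r rN => // *; rewrite mem_carets0.
Qed.

Theorem theorem4p1 (w : thompsonF) (Tm Tp : tree) :
  dead_end w -> reduced_diagram w (Tm, Tp) ->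
  form_minus Tm /\ form_plus Tm Tp.
Proof.
move=> de red; have rep0 := represents_reduced (dead_end_neq1 de) red.
have szmp := size_kinds_eq rep0; have [TmN TpN _ _ _] := rep0.
have rep := represents_iter_pad 3 rep0.
have [l [m [n [r eS]]]] := pad3 Tm; rewrite eS in rep.
have [m1 [m2 em]] := dead_end_middle de rep.
have [l1 [l2 el]] := dead_end_left de rep.
rewrite {}em {}el in rep eS.
have bL := dead_end_root de rep.
have [n0 dR nrf] := dead_end_right de rep.
set p := spine_pos l1 l2 in bL; set d := spine_pos _ _ in dR nrf.
rewrite n0 in rep nrf eS.
have mR : label_at Tm d = Rgt.
  by rewrite -(label_at_iter_pad 3) // eS label_at_spine0 label_right.
rewrite label_at_iter_pad // in bL; rewrite label_at_iter_pad // in dR.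
(* With fewer than two carets after d, both trees would have only [Rgt] from d on. *)
have ltd : d.+2 < size (kinds true true Tm).
  rewrite ltnNge; apply/negP => le; apply: nrf => k dk; rewrite -eS !label_at_iter_pad //.
  by split; apply: label_at_right_end dk => //; rewrite -?szmp.
(* Padding only appends carets at the end, so by [ltd] the carets b, d, e and one below e belong to
   [Tm] itself. *)
have [r' rN eT] : exists2 r', r' <> Leaf &
    Tm = Caret (Caret l1 l2) (Caret (Caret m1 m2) (Caret Leaf r')).
  case: (Tm) TmN eS ltd => // tl [|tm [|tn tr]] _ /=.
  - by case.
  - by case=> -> -> _; rewrite /d /spine_pos /= !size_cat /= !size_cat /=; lia.
  case=> -> -> -> _ ltd; exists tr => // tr0; move: ltd.
  by rewrite tr0 /d /spine_pos /= !size_cat /= !size_cat /=; lia.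
split; first by rewrite eT; apply: dead_end_form_minus.
have pp : infix_number Tm vb = p.
  by rewrite eT infix_number0 -(size_kinds true false) /p /spine_pos /= size_cat /= addnS.
have dp : infix_number Tm vd = d.
  rewrite eT infix_numberR infix_number0 -(size_kinds true false).
  by rewrite -(size_kinds false false).
have ep : infix_number Tm ve = d.+1.
  rewrite eT 2!infix_numberR infix_number0 [size (carets Leaf)]/= addn0 addnS.
  by rewrite -(size_kinds true false) -(size_kinds false false).
rewrite szmp in ltd; have ltp : p < size (kinds true true Tp).
  by apply: leq_trans ltd; rewrite /d /p /spine_pos /= !size_cat /=; lia.
set b := nth [::] (carets Tp) p.
have ltb : p < size (carets Tp) by rewrite -(size_kinds true true).
have bT : b \in carets Tp by apply: mem_nth.
have bp : infix_number Tp b = p by rewrite /infix_number index_uniq // uniq_carets.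
have bS : on_left_side b.
  have := label_at_Lft ltp bL; rewrite /kind_at kinds_carets (nth_map [::]) // -/b /=.
  by case: on_left_side => //; case: on_right_side.
have [kd_d ex_d] := label_at_Rgt (ltnW (ltnW ltd)) dR.
have [|v [vT vR vN vp [eT1 ep1 eL1 eR1]]] := right_caret_child ltd _ ex_d.
  by rewrite -kd_d; apply: set_nth_default; apply: ltnW; apply: ltnW.
exists b, v, (rcons v true); split.
- by split.
- by rewrite pp dp ep.
- split; first by rewrite /left_caret /on_left_side all_rcons.
    by rewrite bp /p /spine_pos.
  by apply: left_caret_child => //; rewrite bp /p /spine_pos.
- split=> //; rewrite /right_caret /on_right_side all_rcons /= -/(on_right_side v) vR.
  by rewrite andbT; apply: vN.
- by split.
Qed.
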